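(* Let $\alpha\ge0$, $0\le\beta<1$, and $f=h+\overline{g}\in\mathcal{W}_{\mathcal{H}}^0(\alpha,\beta)$. If the integers $p,q\ge1$ satisfy one of (i) $1=p<q$, (ii) $3\le p<q$, (iii) $3\le q<p$, then the partial sum $s_{p,q}(f)$ is a convex harmonic mapping in the disk $|z|<1/4$ (i.e. it is univalent there and maps $\{|z|<1/4\}$ onto a convex domain).
   Context: Let $\mathbb{D}=\{z\in\mathbb{C}:|z|<1\}$. $\mathcal{H}^0$ denotes the class of harmonic maps $f=h+\overline{g}$ on $\mathbb{D}$, with $h,g$ analytic in $\mathbb{D}$, $h(z)=z+\sum_{n\ge2}a_nz^n$ and $g(z)=\sum_{n\ge2}b_nz^n$. For $\alpha\ge0$, $0\le\beta<1$, $\mathcal{W}_{\mathcal{H}}^0(\alpha,\beta)$ denotes the class of $f=h+\overline{g}\in\mathcal{H}^0$ such that $\Re\big(h'(z)+\alpha zh''(z)-\beta\big)>|g'(z)+\alpha zg''(z)|$ for all $z\in\mathbb{D}$. For such $f$ and integers $p,q\ge1$, the $(p,q)$-th partial sum is $s_{p,q}(f)=s_p(h)+\overline{s_q(g)}$, where $s_p(h)(z)=z+\sum_{k=2}^pa_kz^k$ and $s_q(g)(z)=\sum_{k=2}^qb_kz^k$ (empty sums are $0$). *)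

(* Defs.v *)
From Stdlib Require Import Reals Lra List.
Import ListNotations.
Open Scope R_scope.

Definition Cx : Type := (R * R)%type.

Definition RtoC (x : R) : Cx := (x, 0).
Definition C0 : Cx := (0, 0).
Definition Cadd (z w : Cx) : Cx := (fst z + fst w, snd z + snd w).
Definition Copp (z : Cx) : Cx := (- fst z, - snd z).
Definition Csub (z w : Cx) : Cx := Cadd z (Copp w).
Definition Cmul (z w : Cx) : Cx :=
  (fst z * fst w - snd z * snd w, fst z * snd w + snd z * fst w).
Definition Cconj (z : Cx) : Cx := (fst z, - snd z).
Definition Re (z : Cx) : R := fst z.
Definition Cnorm (z : Cx) : R := sqrt (fst z * fst z + snd z * snd z).
Fixpoint Cpow (z : Cx) (n : nat) : Cx :=
  match n with O => (1, 0) | S m => Cmul z (Cpow z m) end.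

(* Finite sum  sum_{k = lo}^{hi} u k  (empty, i.e. 0, when hi < lo). *)
Definition Csum (u : nat -> Cx) (lo hi : nat) : Cx :=
  fold_right Cadd C0 (map u (seq lo (S hi - lo))).

Definition Cseries (u : nat -> Cx) (l : Cx) : Prop :=
  forall eps : R, eps > 0 -> exists N : nat, forall n : nat, (n >= N)%nat ->
    Cnorm (Csub (Csum u 0 n) l) < eps.

Definition has_cderiv (f : Cx -> Cx) (z l : Cx) : Prop :=
  forall eps : R, eps > 0 -> exists delta : R, delta > 0 /\
    forall w : Cx, Cnorm (Csub w z) < delta ->
      Cnorm (Csub (Csub (f w) (f z)) (Cmul l (Csub w z))) <= eps * Cnorm (Csub w z).

Definition in_WH0 (alpha beta : R) (a b : nat -> Cx)
    (h h1 h2 g g1 g2 : Cx -> Cx) : Prop :=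
  forall z : Cx, Cnorm z < 1 ->
    Cseries (fun n => Cmul (a (n + 2)%nat) (Cpow z (n + 2))) (Csub (h z) z) /\
    Cseries (fun n => Cmul (b (n + 2)%nat) (Cpow z (n + 2))) (g z) /\
    has_cderiv h z (h1 z) /\ has_cderiv h1 z (h2 z) /\
    has_cderiv g z (g1 z) /\ has_cderiv g1 z (g2 z) /\
    Re (Cadd (h1 z) (Cmul (RtoC alpha) (Cmul z (h2 z)))) - beta >
      Cnorm (Cadd (g1 z) (Cmul (RtoC alpha) (Cmul z (g2 z)))).

Definition s_h (a : nat -> Cx) (p : nat) (z : Cx) : Cx :=
  Cadd z (Csum (fun k => Cmul (a k) (Cpow z k)) 2 p).
Definition s_g (b : nat -> Cx) (q : nat) (z : Cx) : Cx :=
  Csum (fun k => Cmul (b k) (Cpow z k)) 2 q.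
Definition s_pq (a b : nat -> Cx) (p q : nat) (z : Cx) : Cx :=
  Cadd (s_h a p z) (Cconj (s_g b q z)).

Definition univalent_on_disk (F : Cx -> Cx) (r : R) : Prop :=
  forall z w : Cx, Cnorm z < r -> Cnorm w < r -> F z = F w -> z = w.
Definition convex_image_disk (F : Cx -> Cx) (r : R) : Prop :=
  forall z1 z2 : Cx, forall t : R, Cnorm z1 < r -> Cnorm z2 < r -> 0 <= t <= 1 ->
    exists z : Cx, Cnorm z < r /\
      F z = Cadd (Cmul (RtoC (1 - t)) (F z1)) (Cmul (RtoC t) (F z2)).
Definition convex_harmonic_on_disk (F : Cx -> Cx) (r : R) : Prop :=
  univalent_on_disk F r /\ convex_image_disk F r.

(* Main.v *)
(** A dominated pair (g' with Re h' - beta > |g'|, in its alpha-version) has Taylor coefficients that are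
    controlled by Fourier averages over circles: with t_n = a_n + c b_n for a unimodular c, the numbers
    2 t_2 and 3 t_3 satisfy Caratheodory's inequality |x_2 - x_1^2 / 2| <= 2 - |x_1|^2 / 2, moreover
    n (|a_n| + |b_n|) <= 2 and n |b_n| <= 1.

    For an analytic polynomial T and w = z' / z with |z'| <= |z| = 1/4 one has
    T z - T z' = (1 - w) z T' z - (1 - w)^2 S, where S is a weighted sum of the terms of T; since
    Re (1 - w) >= |1 - w|^2 / 2, the line through T z orthogonal to z T' z supports the image as soon as
    2 |S| < |z T' z|. The coefficient bounds give this inequality for s_p h + c s_q g.

    For the harmonic map F with unit normal n at z, the choice c = n^2 turns the supporting lines of the
    analytic maps into supporting lines of F. Finally F is a perturbation of the identity by a contraction,
    hence injective; extend it radially beyond |z| = 1/4 to a bijection of the plane. A convex combination of image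
    points whose preimage were not in the disk would lie on the wrong side of a supporting line. *)

Require Import Defs.
From Stdlib Require Import Reals Lra Lia Psatz List.
From Coquelicot Require Import Coquelicot.
Open Scope R_scope.

(** * The Caratheodory margin *)

Lemma quadratic_pos (a b c u : R) :
  0 < a -> 0 < 4 * a * c - b * b -> 0 < a * (u * u) + b * u + c.
Proof.
  intros Ha Hd.
  apply (Rmult_lt_reg_l (4 * a)); [lra|].
  generalize (Rle_0_sqr (2 * a * u + b)); unfold Rsqr; lra.
Qed.

(* Minus the discriminant of the quadratic polynomial in [u] that arises in [radial_ineq]. *)
Lemma disc_pos (r : R) : 0 <= r <= 1 / 2 ->
  0 < 124 / 81 - 430 / 81 * r + 1255 / 648 * r ^ 2 + 2549 / 243 * r ^ 3
      - 2191 / 243 * r ^ 4 + 112 / 81 * r ^ 5 - 320 / 729 * r ^ 6.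
Proof.
  intros Hr.
  (* Bernstein expansion on [0, 1/2]: all coefficients are positive. *)
  pose (x := 2 * r); pose (y := 1 - 2 * r).
  replace (_ - _) with
    (124 / 81 * y ^ 6 + 529 / 81 * (x * y ^ 5) + 26375 / 2592 * (x ^ 2 * y ^ 4)
     + 7117 / 972 * (x ^ 3 * y ^ 3) + 5239 / 1944 * (x ^ 4 * y ^ 2)
     + 1361 / 1944 * (x ^ 5 * y) + 3377 / 23328 * x ^ 6)
    by (unfold x, y; field).
  assert (Hx : 0 <= x) by (unfold x; lra).
  assert (Hy : 0 <= y) by (unfold y; lra).
  assert (P : forall i j, 0 <= x ^ i * y ^ j)
    by (intros; apply Rmult_le_pos; apply pow_le; assumption).
  assert (P1 := P 1%nat 5%nat); assert (P2 := P 2%nat 4%nat).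
  assert (P3 := P 3%nat 3%nat); assert (P4 := P 4%nat 2%nat).
  assert (P5 := P 5%nat 1%nat); rewrite pow_1 in P1, P5.
  assert (Hx6 : 0 <= x ^ 6) by (apply pow_le; assumption).
  destruct (Req_dec y 0) as [Hy0|Hy0].
  - assert (0 < x ^ 6) by (apply pow_lt; unfold x, y in *; lra).
    assert (0 <= y ^ 6) by (apply pow_le; assumption). lra.
  - assert (0 < y ^ 6) by (apply pow_lt; lra). lra.
Qed.

(* For a complex [x] with modulus [r] and real part [u]: [m = |1 + 2x/3|] and [v = |1 + x + x^2/2|].
   The square root [m] is replaced by its tangent at [m = 3/4], which is near the critical case. *)
Lemma radial_ineq (m u r v : R) :
  0 <= r <= 1 / 2 -> 0 <= v ->
  m ^ 2 = 1 + 4 / 3 * u + 4 / 9 * r ^ 2 ->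
  v ^ 2 = 1 + 2 * u + 2 * u ^ 2 + r ^ 2 * u + r ^ 4 / 4 ->
  r * m + 5 / 9 - 7 / 6 * r ^ 2 < v.
Proof.
  intros Hr Hv Hm Hv2.
  pose (L := r * (2 / 3 * m ^ 2 + 3 / 8) + 5 / 9 - 7 / 6 * r ^ 2).
  assert (HL : r * m + 5 / 9 - 7 / 6 * r ^ 2 <= L).
  { unfold L.
    assert (m <= 2 / 3 * m ^ 2 + 3 / 8) by (generalize (pow2_ge_0 (m - 3 / 4)); lra).
    assert (r * m <= r * (2 / 3 * m ^ 2 + 3 / 8)) by (apply Rmult_le_compat_l; lra).
    lra. }
  apply Rle_lt_trans with L; [exact HL|].
  apply Rnot_le_lt; intros Hle.
  assert (Hsq : v ^ 2 <= L ^ 2) by (apply pow_incr; lra).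
  (* Once [m ^ 2] is substituted, [L] is affine in [u], so [v ^ 2 - L ^ 2] is a quadratic in [u],
     and [disc_pos] says that its discriminant is negative. *)
  pose (L0 := r * (2 / 3 * (1 + 4 / 9 * r ^ 2) + 3 / 8) + 5 / 9 - 7 / 6 * r ^ 2).
  assert (EL : L = L0 + 8 / 9 * r * u) by (unfold L, L0; rewrite Hm; field).
  assert (Hpos : 0 < (2 - 64 / 81 * r ^ 2) * (u * u) + (2 + r ^ 2 - 16 / 9 * r * L0) * u
                     + (1 + r ^ 4 / 4 - L0 ^ 2)).
  { apply quadratic_pos.
    - nra.
    - generalize (disc_pos r Hr). unfold L0. intros H. field_simplify. field_simplify in H. lra. }
  rewrite Hv2, EL in Hsq. lra.
Qed.

Lemma Cmod_minus_le (z w : C) : Cmod z - Cmod w <= Cmod (z + w).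
Proof.
  generalize (Cmod_triangle (z + w) (- w)); rewrite Cmod_opp.
  replace (z + w + - w)%C with z by ring. lra.
Qed.

(* [13/72] is the room needed by the terms of degree at least 4: it is [8 * defect_tail 2 3 + 4 * euler_tail 2 3]. *)
Lemma caratheodory_margin (x X w : C) :
  Cmod (X - x * x / 2) <= 1 / 8 - Cmod x ^ 2 / 2 -> Cmod w <= 1 ->
  Cmod (x + 2 * X * (2 + w) / 3) + 13 / 72 < Cmod (1 + x + X).
Proof.
  intros HX Hw.
  set (y := (X - x * x / 2)%C) in *.
  pose (r := Cmod x); fold r in HX.
  assert (Hr0 : 0 <= r) by apply Cmod_ge_0.
  assert (Hy0 := Cmod_ge_0 y).
  assert (Hr : r <= 1 / 2) by nra.
  assert (EX : X = (x * x / 2 + y)%C) by (unfold y; field).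
  pose (m := Cmod (1 + 2 / 3 * x)). pose (v := Cmod (1 + x + x * x / 2)).
  (* The constants anticipate the end: the [y]-terms cost at most [3 * Cmod y <= 3/8 - 3/2 * r^2].
     Adding [r^2/3] and [13/72] gives [5/9 - 7/6 * r^2]. *)
  assert (Hrad : r * m + 5 / 9 - 7 / 6 * r ^ 2 < v).
  { apply radial_ineq with (u := fst x); [lra|apply Cmod_ge_0| |];
    unfold m, v, r; replace (Cmod x ^ 4) with ((Cmod x ^ 2) ^ 2) by ring;
    rewrite !Cmod2_alt; unfold Re, Im; destruct x as [x1 x2]; simpl; field. }
  assert (Hv : v - Cmod y <= Cmod (1 + x + X)).
  { rewrite EX. unfold v. replace (1 + x + (x * x / 2 + y))%C with (1 + x + x * x / 2 + y)%C by ring.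
    apply Cmod_minus_le. }
  assert (HC : forall t : R, 0 <= t -> Cmod t = t) by (intros; rewrite Cmod_R; apply Rabs_pos_eq; assumption).
  assert (H2w : Cmod (2 + w) <= 3).
  { eapply Rle_trans; [apply Cmod_triangle|]. rewrite HC; lra. }
  assert (Hl : Cmod (x + 2 * X * (2 + w) / 3) <= r * m + r ^ 2 / 3 + 2 * Cmod y).
  { replace (x + 2 * X * (2 + w) / 3)%C
      with (x * (1 + 2 / 3 * x) + (RtoC (1 / 3) * (x * x) * w + RtoC (2 / 3) * y * (2 + w)))%C
      by (rewrite EX, !RtoC_div by lra; field).
    eapply Rle_trans; [apply Cmod_triangle|].
    rewrite Cmod_mult. fold m r. rewrite Rplus_assoc. apply Rplus_le_compat_l.
    eapply Rle_trans; [apply Cmod_triangle|].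
    rewrite !Cmod_mult, !HC by lra. fold r.
    apply Rplus_le_compat; nra. }
  lra.
Qed.

(** * Supporting lines of analytic polynomials *)

(* The type of [sum_n] is a projection of a canonical structure, in which [ring] does not recognize [C] or [R]. *)
Ltac sum_ring := match goal with |- @eq _ ?a ?b => first [change (@eq C a b) | change (@eq R a b)]; ring end.

Lemma Csum_n_S (u : nat -> C) (n : nat) : sum_n u (S n) = (sum_n u n + u (S n))%C.
Proof. exact (sum_Sn u n). Qed.

Lemma Rsum_n_S (u : nat -> R) (n : nat) : sum_n u (S n) = sum_n u n + u (S n).
Proof. exact (sum_Sn u n). Qed.

Lemma Cmod_sum_n (u : nat -> C) (n : nat) : Cmod (sum_n u n) <= sum_n (fun k => Cmod (u k)) n.
Proof.
  induction n as [|n IH]; [rewrite !sum_O; apply Rle_refl|].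
  rewrite Csum_n_S, Rsum_n_S.
  eapply Rle_trans; [apply Cmod_triangle|]. lra.
Qed.

Lemma Cmod_pow (z : C) (n : nat) : Cmod (z ^ n) = Cmod z ^ n.
Proof.
  induction n as [|n IH]; simpl; [apply Cmod_1|]. rewrite Cmod_mult, IH. reflexivity.
Qed.

Lemma Cmod_INR (n : nat) : Cmod (INR n) = INR n.
Proof. rewrite Cmod_R. apply Rabs_pos_eq, pos_INR. Qed.

Lemma RtoC_INR_S (n : nat) : RtoC (INR (S n)) = (INR n + 1)%C.
Proof. rewrite S_INR. apply RtoC_plus. Qed.

Lemma re_mult_le (z w : C) : Re (z * w) <= Cmod z * Cmod w.
Proof.
  rewrite <- Cmod_mult. eapply Rle_trans; [apply Rle_abs|apply re_le_Cmod].
Qed.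

(** This is [(k-1) + (k-2) w + ... + w^(k-2)], the quotient of [k (1 - w) - (1 - w^k)] by
    [(1 - w)^2]. The recursion avoids dividing by [1 - w]; the coefficients add up to
    [k (k-1) / 2]. *)
Fixpoint qpow (w : C) (k : nat) : C :=
  match k with O => RtoC 0 | S j => (INR j + w * qpow w j)%C end.

Lemma qpow_spec (w : C) (k : nat) :
  (1 - w ^ k = INR k * (1 - w) - (1 - w) * (1 - w) * qpow w k)%C.
Proof.
  induction k as [|k IH]; [simpl; ring|].
  rewrite RtoC_INR_S. simpl Cpow. cbn [qpow].
  replace (1 - w * w ^ k)%C with (w * (1 - w ^ k) + (1 - w))%C by ring.
  rewrite IH. ring.
Qed.

Lemma qpow_bound (w : C) (k : nat) :
  Cmod w <= 1 -> Cmod (qpow w k) <= INR k * (INR k - 1) / 2.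
Proof.
  intros Hw. induction k as [|k IH]; [simpl; rewrite Cmod_0; lra|].
  cbn [qpow]. eapply Rle_trans; [apply Cmod_triangle|].
  rewrite Cmod_mult, Cmod_INR, S_INR.
  assert (H0 := Cmod_ge_0 (qpow w k)). assert (H1 := Cmod_ge_0 w).
  nra.
Qed.

(* With [T = npoly t L]: [euler t L z = z T'(z)], and [defect] is the sum [S] of the second-order terms of
   [T z - T (z w)]. *)
Definition npoly (t : nat -> C) (L : nat) (z : C) : C := (z + sum_n (fun k => t k * z ^ k)%C L)%C.
Definition euler (t : nat -> C) (L : nat) (z : C) : C :=
  (z + sum_n (fun k => INR k * (t k * z ^ k))%C L)%C.
Definition defect (t : nat -> C) (L : nat) (z w : C) : C :=
  sum_n (fun k => t k * z ^ k * qpow w k)%C L.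

Lemma Cpow_mult_l (z w : C) (n : nat) : ((z * w) ^ n = z ^ n * w ^ n)%C.
Proof. induction n as [|n IH]; simpl; [ring|rewrite IH; sum_ring]. Qed.

Lemma npoly_diff (t : nat -> C) (L : nat) (z w : C) :
  (npoly t L z - npoly t L (z * w)
   = (1 - w) * euler t L z - (1 - w) * (1 - w) * defect t L z w)%C.
Proof.
  unfold npoly, euler, defect.
  assert (H : (sum_n (fun k => t k * z ^ k) L - sum_n (fun k => t k * (z * w) ^ k) L
    = (1 - w) * sum_n (fun k => INR k * (t k * z ^ k)) L
      - (1 - w) * (1 - w) * sum_n (fun k => t k * z ^ k * qpow w k) L)%C).
  { assert (K : forall k, (t k * z ^ k - t k * (z * w) ^ k
      = (1 - w) * (INR k * (t k * z ^ k)) - (1 - w) * (1 - w) * (t k * z ^ k * qpow w k))%C).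
    { intros k. rewrite Cpow_mult_l.
      replace (t k * z ^ k - t k * (z ^ k * w ^ k))%C with (t k * z ^ k * (1 - w ^ k))%C by sum_ring.
      rewrite qpow_spec. sum_ring. }
    induction L as [|L IH]; [rewrite !sum_O; apply K|].
    rewrite !Csum_n_S.
    transitivity ((sum_n (fun k => t k * z ^ k) L - sum_n (fun k => t k * (z * w) ^ k) L)
      + (t (S L) * z ^ S L - t (S L) * (z * w) ^ S L))%C; [ring|].
    rewrite IH, K. sum_ring. }
  replace (z + sum_n (fun k => t k * z ^ k) L - (z * w + sum_n (fun k => t k * (z * w) ^ k) L))%C
    with (z * (1 - w) + (sum_n (fun k => t k * z ^ k) L - sum_n (fun k => t k * (z * w) ^ k) L))%C by sum_ring.
  rewrite H. sum_ring.
Qed.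

Definition supporting (t : nat -> C) (L : nat) (r : R) : Prop :=
  forall z w : C, Cmod z = r -> Cmod w <= 1 -> 2 * Cmod (defect t L z w) < Cmod (euler t L z).

Lemma supporting_line (t : nat -> C) (L : nat) (r : R) (z w : C) :
  supporting t L r -> Cmod z = r -> Cmod w <= 1 -> w <> 1 ->
  0 < Re ((npoly t L z - npoly t L (z * w)) * Cconj (euler t L z)).
Proof.
  intros HS Hz Hw Hw1. specialize (HS z w Hz Hw).
  rewrite npoly_diff.
  set (E := euler t L z) in *. set (D := defect t L z w) in *.
  pose (d := (1 - w)%C).
  assert (Hd : 0 < Cmod d).
  { apply Cmod_gt_0. intros H. apply Hw1. symmetry. apply Ceq_minus, H. }
  (* From [|1 - w|^2 = 1 - 2 Re w + |w|^2] and [|w| <= 1]. *)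
  assert (Hred : Cmod d ^ 2 / 2 <= Re d).
  { assert (H := Cmod2_alt w). rewrite Cmod2_alt. unfold d, Re, Im in *. simpl in *.
    assert (Cmod w * (Cmod w * 1) <= 1) by (generalize (Cmod_ge_0 w); nra). nra. }
  replace (((1 - w) * E - (1 - w) * (1 - w) * D) * Cconj E)%C
    with (d * (E * Cconj E) + - (d * d * D * Cconj E))%C by (unfold d; ring).
  rewrite re_plus, <- Cmod2_conj.
  assert (H1 : Re (d * RtoC (Cmod E ^ 2)) = Re d * Cmod E ^ 2).
  { destruct d; unfold Re; simpl; ring. }
  assert (H2 : - (Cmod d ^ 2 * Cmod D * Cmod E) <= Re (- (d * d * D * Cconj E))).
  { rewrite re_opp. apply Ropp_le_contravar.
    eapply Rle_trans; [apply re_mult_le|]. rewrite Cmod_conj, !Cmod_mult. apply Req_le; ring. }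
  rewrite H1.
  assert (HD := Cmod_ge_0 D).
  assert (0 < Cmod d ^ 2) by (apply pow_lt; assumption).
  assert (Cmod d ^ 2 / 2 * Cmod E ^ 2 <= Re d * Cmod E ^ 2)
    by (apply Rmult_le_compat_r; [apply pow2_ge_0|assumption]).
  assert (0 < Cmod d ^ 2 * (Cmod E * (Cmod E / 2 - Cmod D)))
    by (apply Rmult_lt_0_compat; [assumption|apply Rmult_lt_0_compat; lra]).
  lra.
Qed.

(** * Fixed points and projection onto a disk *)

Lemma Cmod_le_abs (z : C) : Cmod z <= Rabs (Re z) + Rabs (Im z).
Proof.
  apply Rsqr_incr_0_var.
  - unfold Rsqr. replace (Cmod z * Cmod z) with (Cmod z ^ 2) by ring.
    rewrite Cmod2_alt, <- (pow2_abs (Re z)), <- (pow2_abs (Im z)).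
    generalize (Rabs_pos (Re z)) (Rabs_pos (Im z)); nra.
  - generalize (Rabs_pos (Re z)) (Rabs_pos (Im z)); lra.
Qed.

Lemma im_le_Cmod (z : C) : Rabs (Im z) <= Cmod z.
Proof. eapply Rle_trans; [apply Rmax_r|apply Rmax_Cmod]. Qed.

Lemma cauchy_geometric (x : nat -> R) (k M : R) :
  0 <= k < 1 -> (forall n, Rabs (x (S n) - x n) <= M * k ^ n) -> exists l : R, is_lim_seq x l.
Proof.
  intros Hk Hx.
  assert (E : ex_series (fun n => x (S n) - x n)).
  { apply @ex_series_le with (b := fun n => M * k ^ n); [exact Hx|].
    apply (ex_series_scal_l M (fun n => k ^ n)), ex_series_geom.
    rewrite Rabs_pos_eq; lra. }
  destruct E as [l Hl].
  exists (l + x O). apply is_lim_seq_incr_1.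
  apply is_lim_seq_ext with (u := fun n => sum_n (fun n => x (S n) - x n) n + x O).
  { intros n. induction n as [|n IH]; [rewrite sum_O; ring|]. rewrite Rsum_n_S. lra. }
  apply is_lim_seq_plus' with (l1 := l) (l2 := x O); [exact Hl|apply is_lim_seq_const].
Qed.

(** Banach's theorem by Picard iteration from 0. Real and imaginary parts converge separately, so
    only limits of real sequences occur. *)
Lemma contraction_fixpoint (f : C -> C) (k : R) :
  0 <= k < 1 -> (forall z w, Cmod (f z - f w) <= k * Cmod (z - w)) -> exists z, f z = z.
Proof.
  intros Hk Hf.
  pose (x := fix x n := match n with O => RtoC 0 | S m => f (x m) end).
  pose (M := Cmod (x 1%nat - x O)).
  assert (Hd : forall n, Cmod (x (S n) - x n) <= M * k ^ n).
  { induction n as [|n IH]; [rewrite pow_O, Rmult_1_r; apply Rle_refl|].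
    change (x (S (S n))) with (f (x (S n))). change (x (S n)) with (f (x n)) at 2.
    eapply Rle_trans; [apply Hf|]. simpl pow. nra. }
  destruct (cauchy_geometric (fun n => Re (x n)) k M Hk) as [l1 H1].
  { intros n. eapply Rle_trans; [|apply Hd].
    replace (Re (x (S n)) - Re (x n)) with (Re (x (S n) - x n)) by reflexivity. apply re_le_Cmod. }
  destruct (cauchy_geometric (fun n => Im (x n)) k M Hk) as [l2 H2].
  { intros n. eapply Rle_trans; [|apply Hd].
    replace (Im (x (S n)) - Im (x n)) with (Im (x (S n) - x n)) by reflexivity. apply im_le_Cmod. }
  exists (l1, l2). set (l := (l1, l2) : C).
  apply Ceq_minus, Cmod_eq_0, Rle_antisym; [|apply Cmod_ge_0].
  pose (e := fun n => Rabs (Re (x n) - l1) + Rabs (Im (x n) - l2)).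
  assert (He : is_lim_seq e 0).
  { assert (K : forall (u : nat -> R) (l : R), is_lim_seq u l -> is_lim_seq (fun n => Rabs (u n - l)) 0).
    { intros u l0 Hu. apply -> is_lim_seq_abs_0.
      rewrite <- (Rminus_diag l0). apply is_lim_seq_minus'; [exact Hu|apply is_lim_seq_const]. }
    rewrite <- (Rplus_0_r 0). apply is_lim_seq_plus'; apply K; assumption. }
  assert (Hb : forall n, Cmod (x n - l) <= e n).
  { intros n. apply Cmod_le_abs. }
  assert (Hs : is_lim_seq (fun n => e n + e (S n)) 0).
  { rewrite <- (Rplus_0_r 0). apply is_lim_seq_plus'; [exact He|].
    apply is_lim_seq_incr_1 with (u := e), He. }
  change (Rbar_le (Cmod (f l - l)) 0).
  (* The constant [|f l - l|] is squeezed by [|x n - l| + |x (n+1) - l|], which tends to 0. *)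
  apply (is_lim_seq_le (fun _ => Cmod (f l - l)) (fun n => e n + e (S n))); [|apply is_lim_seq_const|exact Hs].
  intros n. replace (f l - l)%C with ((f l - f (x n)) + (f (x n) - l))%C by ring.
  eapply Rle_trans; [apply Cmod_triangle|]. apply Rplus_le_compat; [|exact (Hb (S n))].
  eapply Rle_trans; [apply Hf|]. replace (l - x n)%C with (- (x n - l))%C by ring.
  rewrite Cmod_opp. generalize (Hb n) (Cmod_ge_0 (x n - l)). nra.
Qed.

(** The radial retraction is the nearest-point projection onto the closed disk, hence nonexpansive.
    The factor [s] records that an outside point lies on the ray through its projection. *)
Lemma disc_projection (r : R) : 0 < r -> exists p : C -> C,
  (forall z, Cmod (p z) <= r) /\
  (forall z w, Cmod (p z - p w) <= Cmod (z - w)) /\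
  (forall z, Cmod z < r -> p z = z) /\
  (forall z, r <= Cmod z -> Cmod (p z) = r /\ exists s : R, 1 <= s /\ z = (s * p z)%C).
Proof.
  intros Hr.
  pose (p := fun z : C => if Rle_dec r (Cmod z) then (r / Cmod z * z)%C else z).
  assert (Hin : forall z, Cmod z < r -> p z = z).
  { intros z Hz. unfold p. destruct (Rle_dec r (Cmod z)); [lra|reflexivity]. }
  assert (Hout : forall z, r <= Cmod z -> Cmod (p z) = r /\ exists s : R, 1 <= s /\ z = (s * p z)%C).
  { intros z Hz. unfold p. destruct (Rle_dec r (Cmod z)) as [_|]; [|contradiction].
    assert (Hnz : RtoC (Cmod z) <> 0%C) by (intros H; apply RtoC_inj in H; lra).
    split.
    - rewrite <- RtoC_div, Cmod_mult, Cmod_R, Rabs_pos_eq by (try apply Rdiv_le_0_compat; lra).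
      field; lra.
    - exists (Cmod z / r). split.
      + apply (Rmult_le_reg_r r); [lra|]. replace (Cmod z / r * r) with (Cmod z) by (field; lra). lra.
      + rewrite RtoC_div by lra. field. split; [exact Hnz|intros H; apply RtoC_inj in H; lra]. }
  assert (Hle : forall z, Cmod (p z) <= r).
  { intros z. destruct (Rle_lt_dec r (Cmod z)) as [H|H].
    - apply Req_le, Hout, H.
    - rewrite Hin by exact H. lra. }
  (* The variational inequality of the nearest-point projection. Used once for [z] and [p w] and
     once for [w] and [p z], it gives [|p z - p w|^2 <= Re ((z - w) * conj (p z - p w))]. *)
  assert (Hvar : forall z v, Cmod v <= r -> Re ((z - p z) * Cconj (v - p z)) <= 0).
  { intros z v Hv. destruct (Rle_lt_dec r (Cmod z)) as [H|H].
    - destruct (Hout z H) as [Hp [s [Hs Ez]]]. set (q := p z) in *.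
      assert (H1 : Re (q * Cconj v) <= r * r).
      { eapply Rle_trans; [apply re_mult_le|]. rewrite Cmod_conj, Hp. nra. }
      assert (H2 := Cmod2_alt q). rewrite Hp in H2.
      rewrite Ez. unfold Re, Im in *. destruct q as [q1 q2], v as [v1 v2]. simpl in *. nra.
    - rewrite Hin by exact H. unfold Re; simpl. lra. }
  exists p. split; [exact Hle|]. split; [|split; assumption].
  intros z w. assert (H1 := Hvar z (p w) (Hle w)). assert (H2 := Hvar w (p z) (Hle z)).
  set (P := p z) in *. set (Q := p w) in *.
  assert (H3 : Cmod (P - Q) ^ 2 <= Cmod (z - w) * Cmod (P - Q)).
  { rewrite <- (Cmod_conj (P - Q)) at 2. eapply Rle_trans; [|apply re_mult_le].
    rewrite Cmod2_alt. unfold Re, Im in *. simpl in *. lra. }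
  assert (H4 := Cmod_ge_0 (P - Q)). assert (H5 := Cmod_ge_0 (z - w)). nra.
Qed.

(** * Supporting lines and convexity of harmonic polynomials *)

Definition psum (B : nat -> C) (L : nat) (z : C) : C := sum_n (fun k => B k * z ^ k)%C L.
Definition harm (A B : nat -> C) (L : nat) (z : C) : C := (npoly A L z + Cconj (psum B L z))%C.

(** Serves as a Lipschitz constant of [psum] on the closed disk of radius [r]. At [k = 0] the value
    of [pred] is harmless because of the factor [INR 0]. *)
Definition deriv_majorant (A : nat -> C) (L : nat) (r : R) : R :=
  sum_n (fun k => INR k * Cmod (A k) * r ^ pred k) L.

Lemma pow_pred_INR (r : R) (k : nat) : r * (INR k * r ^ pred k) = INR k * r ^ k.
Proof. destruct k as [|k]; [simpl; ring|]. change (pred (S k)) with k. rewrite <- tech_pow_Rmult. ring. Qed.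

Lemma Cpow_lipschitz (r : R) (z w : C) (k : nat) :
  Cmod z <= r -> Cmod w <= r -> Cmod (z ^ k - w ^ k) <= INR k * r ^ pred k * Cmod (z - w).
Proof.
  intros Hz Hw. assert (Hr : 0 <= r) by (generalize (Cmod_ge_0 z); lra).
  induction k as [|k IH].
  - simpl. replace (1 - 1)%C with (RtoC 0) by ring. rewrite Cmod_0. lra.
  - simpl Cpow. replace (z * z ^ k - w * w ^ k)%C with (z * (z ^ k - w ^ k) + (z - w) * w ^ k)%C by ring.
    eapply Rle_trans; [apply Cmod_triangle|]. rewrite !Cmod_mult, Cmod_pow.
    assert (H1 : Cmod w ^ k <= r ^ k) by (apply pow_incr; split; [apply Cmod_ge_0|assumption]).
    assert (H2 := Cmod_ge_0 (z - w)). assert (H3 := Cmod_ge_0 (z ^ k - w ^ k)).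
    assert (H4 : Cmod z * Cmod (z ^ k - w ^ k) <= r * (INR k * r ^ pred k * Cmod (z - w)))
      by (apply Rmult_le_compat; [apply Cmod_ge_0|assumption..]).
    rewrite <- !Rmult_assoc, (Rmult_assoc r), pow_pred_INR in H4.
    rewrite S_INR. change (pred (S k)) with k. nra.
Qed.

Lemma psum_lipschitz (A : nat -> C) (L : nat) (r : R) (z w : C) :
  Cmod z <= r -> Cmod w <= r ->
  Cmod (psum A L z - psum A L w) <= deriv_majorant A L r * Cmod (z - w).
Proof.
  intros Hz Hw. unfold psum, deriv_majorant.
  assert (K : forall k, Cmod (A k * z ^ k - A k * w ^ k)
                        <= INR k * Cmod (A k) * r ^ pred k * Cmod (z - w)).
  { intros k. replace (A k * z ^ k - A k * w ^ k)%C with (A k * (z ^ k - w ^ k))%C by ring.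
    rewrite Cmod_mult. generalize (Cpow_lipschitz r z w k Hz Hw) (Cmod_ge_0 (A k)). nra. }
  induction L as [|L IH]; [rewrite !sum_O; apply K|].
  rewrite !Csum_n_S, Rsum_n_S.
  replace (_ - _)%C with ((sum_n (fun k => A k * z ^ k) L - sum_n (fun k => A k * w ^ k) L)
    + (A (S L) * z ^ S L - A (S L) * w ^ S L))%C by sum_ring.
  eapply Rle_trans; [apply Cmod_triangle|]. rewrite Rmult_plus_distr_r.
  apply Rplus_le_compat; [exact IH|apply K].
Qed.

Lemma euler_bound (A : nat -> C) (L : nat) (z : C) :
  Cmod (sum_n (fun k => INR k * (A k * z ^ k))%C L) <= Cmod z * deriv_majorant A L (Cmod z).
Proof.
  unfold deriv_majorant. eapply Rle_trans; [apply Cmod_sum_n|].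
  induction L as [|L IH].
  - rewrite !sum_O. simpl. rewrite !Cmod_mult, Cmod_R, Rabs_R0. lra.
  - rewrite !Rsum_n_S, Rmult_plus_distr_l. apply Rplus_le_compat; [exact IH|].
    rewrite !Cmod_mult, Cmod_INR, Cmod_pow.
    replace (Cmod z * _) with (Cmod (A (S L)) * (Cmod z * (INR (S L) * Cmod z ^ pred (S L)))) by ring.
    rewrite pow_pred_INR. apply Req_le; ring.
Qed.

Lemma psum_lin (c : C) (A B : nat -> C) (L : nat) (z : C) :
  psum (fun k => A k + c * B k)%C L z = (psum A L z + c * psum B L z)%C.
Proof.
  unfold psum. induction L as [|L IH]; [rewrite !sum_O; sum_ring|].
  rewrite !Csum_n_S, IH. sum_ring.
Qed.

Lemma euler_lin (c : C) (A B : nat -> C) (L : nat) (z : C) :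
  euler (fun k => A k + c * B k)%C L z
  = (euler A L z + c * sum_n (fun k => INR k * (B k * z ^ k)) L)%C.
Proof.
  unfold euler.
  assert (H : sum_n (fun k => INR k * ((A k + c * B k) * z ^ k))%C L
    = (sum_n (fun k => INR k * (A k * z ^ k)) L + c * sum_n (fun k => INR k * (B k * z ^ k)) L)%C).
  { induction L as [|L IH]; [rewrite !sum_O; sum_ring|]. rewrite !Csum_n_S, IH. sum_ring. }
  rewrite H. sum_ring.
Qed.

(* With [n] the unit outer normal of the image curve at [z], the real part of [conj n * harm] is that
   of [conj n * npoly (A + n^2 B)], and [n] is also normal to the image under that analytic map. *)
Lemma harmonic_supporting_line (A B : nat -> C) (L : nat) (r : R) (z : C) :
  0 < r -> deriv_majorant A L r + deriv_majorant B L r < 1 ->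
  (forall c : C, Cmod c = 1 -> supporting (fun k => A k + c * B k)%C L r) ->
  Cmod z = r ->
  exists n : C, 0 <= Re (Cconj n * z) /\
    forall w : C, Cmod w <= 1 -> w <> 1 ->
      0 < Re (Cconj n * (harm A B L z - harm A B L (z * w))).
Proof.
  intros Hr HW HS Hz.
  pose (a := euler A L z). pose (b := sum_n (fun k => INR k * (B k * z ^ k))%C L : C).
  pose (a' := sum_n (fun k => INR k * (A k * z ^ k))%C L : C).
  assert (Ea : a = (z + a')%C) by reflexivity.
  assert (Ha : Cmod a' <= r * deriv_majorant A L r) by (rewrite <- Hz; apply euler_bound).
  assert (Hb : Cmod b <= r * deriv_majorant B L r) by (rewrite <- Hz; apply euler_bound).
  assert (Hab : Cmod a' + Cmod b < r) by nra.
  assert (Haz : r - Cmod a' <= Cmod a).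
  { rewrite Ea, <- Hz. apply Cmod_minus_le. }
  (* The derivative of the map in the angle is [i (a - conj b)], so [a - conj b] is normal to the
     image curve. *)
  pose (N := (a - Cconj b)%C).
  assert (HN : 0 < Cmod N).
  { apply Rlt_le_trans with (Cmod a - Cmod (- Cconj b)); [|apply Cmod_minus_le].
    rewrite Cmod_opp, Cmod_conj. lra. }
  pose (n := (/ Cmod N * N)%C).
  assert (HN0 : RtoC (Cmod N) <> 0%C) by (intros H; apply RtoC_inj in H; lra).
  assert (En : N = (Cmod N * n)%C) by (unfold n; field; exact HN0).
  assert (Hn1 : Cmod n = 1).
  { unfold n. rewrite <- RtoC_inv, Cmod_mult, Cmod_R, Rabs_pos_eq by
      (try (left; apply Rinv_0_lt_compat); lra). field; lra. }
  assert (Hnn : Re n ^ 2 + Im n ^ 2 = 1) by (rewrite <- Cmod2_alt, Hn1; ring).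
  set (M := Cmod N) in *.
  exists n. split.
  - apply (Rmult_le_reg_l M); [exact HN|]. rewrite Rmult_0_r.
    replace (M * Re (Cconj n * z)) with (Re (Cconj N * z))
      by (rewrite En; unfold Re; simpl; ring).
    replace (Cconj N * z)%C with (z * Cconj z + - - (Cconj (a' - Cconj b) * z))%C.
    2: { unfold N. rewrite Ea, !Cminus_conj, Cplus_conj. ring. }
    rewrite re_plus, <- Cmod2_conj, Hz, re_opp.
    assert (H1 : Re (- (Cconj (a' - Cconj b) * z)) <= (Cmod a' + Cmod b) * r).
    { eapply Rle_trans; [eapply Rle_trans; [apply Rle_abs|apply re_le_Cmod]|].
      rewrite Cmod_opp, Cmod_mult, Cmod_conj, Hz. apply Rmult_le_compat_r; [lra|].
      eapply Rle_trans; [apply Cmod_triangle|]. rewrite Cmod_opp, Cmod_conj. lra. }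
    change (Re (RtoC (r ^ 2))) with (r ^ 2). nra.
  - intros w Hw Hw1.
    pose (c := (n * n)%C).
    assert (Hc : Cmod c = 1) by (unfold c; rewrite Cmod_mult, Hn1; ring).
    assert (HT := supporting_line _ L r z w (HS c Hc) Hz Hw Hw1).
    rewrite euler_lin in HT. fold a b in HT.
    (* Since [a = M n + conj b] and [|n| = 1], the vector [a + n^2 b] is the real multiple [tau] of
       [n]: both maps share the normal. *)
    pose (tau := M + 2 * Re (n * b)).
    assert (Etau : (a + c * b)%C = (n * tau)%C).
    { assert (Ea' : a = (M * n + Cconj b)%C) by (rewrite <- En; unfold N; ring).
      assert (Hnc : (n * Cconj n = 1)%C) by (rewrite <- Cmod2_conj, Hn1; f_equal; ring).
      assert (Et : RtoC tau = (M + (n * b + Cconj n * Cconj b))%C).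
      { unfold tau. apply injective_projections; unfold Re; simpl; ring. }
      rewrite Ea', Et. unfold c.
      transitivity (M * n + n * n * b + (n * Cconj n) * Cconj b)%C; [rewrite Hnc|]; ring. }
    (* [M * tau = |a|^2 - |b|^2], up to a factor the Jacobian, is positive because
       [|b| < r - |a'| <= |a|]. *)
    assert (Htau : 0 < tau).
    { assert (H : Cmod a ^ 2 = M * tau + Cmod b ^ 2).
      { assert (Ea' : a = (M * n + Cconj b)%C) by (rewrite <- En; unfold N; ring).
        rewrite Ea', !Cmod2_alt. unfold tau.
        transitivity (M ^ 2 * (Re n ^ 2 + Im n ^ 2) + 2 * M * Re (n * b) + (Re b ^ 2 + Im b ^ 2));
          [unfold Re, Im; simpl; ring|rewrite Hnn; ring]. }
      assert (H0 := Cmod_ge_0 b). nra. }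
    rewrite Etau in HT.
    set (d := (psum A L z - psum A L (z * w) + (z - z * w))%C).
    set (e := (psum B L z - psum B L (z * w))%C).
    replace (npoly (fun k => A k + c * B k) L z - npoly (fun k => A k + c * B k) L (z * w))%C
      with (d + c * e)%C in HT.
    2: { unfold npoly. fold (psum (fun k => A k + c * B k)%C L z).
         fold (psum (fun k => A k + c * B k)%C L (z * w)). rewrite !psum_lin. unfold d, e. ring. }
    replace (harm A B L z - harm A B L (z * w))%C with (d + Cconj e)%C.
    2: { unfold harm, npoly. fold (psum A L z) (psum A L (z * w)). unfold d, e. rewrite Cminus_conj. ring. }
    apply (Rmult_lt_reg_l tau); [exact Htau|]. rewrite Rmult_0_r.
    replace (tau * Re (Cconj n * (d + Cconj e))) with (Re ((d + c * e) * Cconj (n * tau))); [exact HT|].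
    clearbody d e tau. unfold c. clear - Hnn. destruct n as [n1 n2], d as [d1 d2], e as [e1 e2].
    unfold Re, Im in *; simpl in *.
    transitivity (tau * (n1 * d1 + n2 * d2 + (n1 * e1 - n2 * e2) * (n1 ^ 2 + n2 ^ 2))); [ring|].
    simpl; rewrite Hnn; ring.
Qed.

Theorem convex_harmonic_of_supporting (A B : nat -> C) (L : nat) (r : R) :
  0 < r -> deriv_majorant A L r + deriv_majorant B L r < 1 ->
  (forall c : C, Cmod c = 1 -> supporting (fun k => A k + c * B k)%C L r) ->
  convex_harmonic_on_disk (harm A B L) r.
Proof.
  intros Hr HW HS.
  pose (k := deriv_majorant A L r + deriv_majorant B L r).
  pose (phi := fun z => (psum A L z + Cconj (psum B L z))%C).
  assert (Eharm : forall z, harm A B L z = (z + phi z)%C).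
  { intros z. unfold harm, npoly, phi. fold (psum A L z). ring. }
  assert (Hphi : forall z w, Cmod z <= r -> Cmod w <= r -> Cmod (phi z - phi w) <= k * Cmod (z - w)).
  { intros z w Hz Hw.
    replace (phi z - phi w)%C with ((psum A L z - psum A L w) + Cconj (psum B L z - psum B L w))%C
      by (unfold phi; rewrite Cminus_conj; ring).
    eapply Rle_trans; [apply Cmod_triangle|]. rewrite Cmod_conj.
    unfold k. rewrite Rmult_plus_distr_r.
    apply Rplus_le_compat; apply psum_lipschitz; assumption. }
  assert (Hpos : forall (t : nat -> C), 0 <= deriv_majorant t L r).
  { intros t. unfold deriv_majorant. induction L as [|M IH]; [rewrite sum_O; simpl; lra|].
    assert (P : forall j, 0 <= INR j * Cmod (t j) * r ^ pred j).
    { intros j. apply Rmult_le_pos; [apply Rmult_le_pos; [apply pos_INR|apply Cmod_ge_0]|apply pow_le; lra]. }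
    clear - P. induction (S M) as [|m IHm]; [rewrite sum_O; apply P|].
    rewrite Rsum_n_S. generalize (P (S m)). lra. }
  assert (Hk : 0 <= k < 1) by (generalize (Hpos A) (Hpos B); unfold k; lra).
  assert (Enorm : forall z, Cnorm z = Cmod z).
  { intros z. unfold Cnorm, Cmod. f_equal. ring. }
  split.
  - intros z w Hz Hw E. rewrite Enorm in Hz, Hw. rewrite !Eharm in E.
    apply Ceq_minus, Cmod_eq_0.
    assert (H := Hphi z w (Rlt_le _ _ Hz) (Rlt_le _ _ Hw)).
    replace (phi z - phi w)%C with (- (z - w))%C in H.
    2: { transitivity ((z + phi z) - (w + phi w) - (z - w))%C; [rewrite E|]; ring. }
    rewrite Cmod_opp in H. assert (H0 := Cmod_ge_0 (z - w)). nra.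
  - intros z1 z2 t Hz1 Hz2 Ht. rewrite Enorm in Hz1, Hz2.
    set (target := Cadd _ _).
    destruct (disc_projection r Hr) as [p [Hp1 [Hp2 [Hp3 Hp4]]]].
    (* The map [z + phi (p z)] extends [harm] to the whole plane; the fixed point is a preimage of
       [target] under this extension. *)
    destruct (contraction_fixpoint (fun z => target - phi (p z))%C k Hk) as [z Hz].
    { intros z w. replace (target - phi (p z) - (target - phi (p w)))%C
        with (- (phi (p z) - phi (p w)))%C by sum_ring.
      rewrite Cmod_opp. eapply Rle_trans; [apply Hphi; apply Hp1|].
      apply Rmult_le_compat_l; [lra|apply Hp2]. }
    exists z. rewrite Enorm.
    destruct (Rlt_le_dec (Cmod z) r) as [Hlt|Hge].
    + split; [exact Hlt|]. rewrite Eharm. rewrite (Hp3 z Hlt) in Hz. rewrite <- Hz at 1. sum_ring.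
    (* Here [target = harm q + (s - 1) q] with [s >= 1], so [target] is on or beyond the supporting
       line at [q], whereas both endpoints of the segment lie strictly inside. *)
    + exfalso. destruct (Hp4 z Hge) as [Hq [s [Hs Es]]]. set (q := p z) in *.
      destruct (harmonic_supporting_line A B L r q Hr HW HS Hq) as [n [Hn Hsup]].
      assert (Hq0 : q <> 0%C) by (apply Cmod_gt_0; lra).
      assert (K : forall v, Cmod v < r -> 0 < Re (Cconj n * (harm A B L q - harm A B L v))).
      { intros v Hv. replace v with (q * (v / q))%C by (field; exact Hq0).
        assert (Hvq : Cmod (v / q) < 1).
        { rewrite Cmod_div, Hq by exact Hq0. apply (Rmult_lt_reg_r r); [exact Hr|].
          replace (Cmod v / r * r) with (Cmod v) by (field; lra). lra. }
        apply Hsup; [lra|]. intros E. rewrite E, Cmod_1 in Hvq. lra. }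
      assert (K1 := K z1 Hz1). assert (K2 := K z2 Hz2).
      assert (Et : (harm A B L q - target)%C = (- ((s - 1)%R * q))%C).
      { rewrite Eharm. replace target with (z + phi q)%C by (rewrite <- Hz at 1; sum_ring).
        rewrite Es, RtoC_minus. sum_ring. }
      assert (Ek : Re (Cconj n * (harm A B L q - target))
        = (1 - t) * Re (Cconj n * (harm A B L q - harm A B L z1))
          + t * Re (Cconj n * (harm A B L q - harm A B L z2))).
      { unfold target. unfold Re; simpl. ring. }
      rewrite Et in Ek.
      replace (Re (Cconj n * - ((s - 1)%R * q))) with (- ((s - 1) * Re (Cconj n * q))) in Ek
        by (unfold Re; simpl; ring).
      assert (0 <= (s - 1) * Re (Cconj n * q)) by (apply Rmult_le_pos; lra).
      nra.
Qed.

(** * Tail estimates on the circle of radius 1/4 *)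

(** [G k] stands for the full tail of a majorant series after index [k], so the bound is uniform in
    [L] and involves only finite sums. *)
Lemma telescoping_tail (u : nat -> C) (G : nat -> R) (j L : nat) :
  (j <= L)%nat -> (forall k, 0 <= G k) ->
  (forall k, (j <= k)%nat -> Cmod (u (S k)) <= G k - G (S k)) ->
  Cmod (sum_n u L - sum_n u j) <= G j.
Proof.
  intros HL HG Hu.
  assert (H : Cmod (sum_n u L - sum_n u j) <= G j - G L).
  { induction HL as [|L HL IH].
    - replace (sum_n u j - sum_n u j)%C with (RtoC 0) by sum_ring. rewrite Cmod_0. lra.
    - rewrite Csum_n_S.
      replace (_ - _)%C with ((sum_n u L - sum_n u j) + u (S L))%C by sum_ring.
      eapply Rle_trans; [apply Cmod_triangle|]. generalize (Hu L HL). lra. }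
  generalize (HG L). lra.
Qed.

Lemma sum_n_telescoping (u G : nat -> R) (j L : nat) :
  (j <= L)%nat -> (forall k, 0 <= G k) ->
  (forall k, (j <= k)%nat -> u (S k) <= G k - G (S k)) ->
  sum_n u L <= sum_n u j + G j.
Proof.
  intros HL HG Hu.
  assert (H : sum_n u L <= sum_n u j + G j - G L).
  { induction HL as [|L HL IH]; [lra|].
    rewrite Rsum_n_S. generalize (Hu L HL). lra. }
  generalize (HG L). lra.
Qed.

(* [euler_tail M k] is [M] times the sum over [i > k] of [4^(-i)], and [defect_tail M k] is [M] times the sum
   over [i > k] of [(i - 1) / 2 * 4^(-i)]. *)
Definition euler_tail (M : R) (k : nat) : R := M / 3 * (1 / 4) ^ k.
Definition defect_tail (M : R) (k : nat) : R := M * (INR k / 6 + 1 / 18) * (1 / 4) ^ k.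

Lemma tails_nonneg (M : R) (k : nat) : 0 <= M -> 0 <= euler_tail M k /\ 0 <= defect_tail M k.
Proof.
  intros HM. assert (H := pos_INR k). assert (0 <= (1 / 4) ^ k) by (apply pow_le; lra).
  split; unfold euler_tail, defect_tail; apply Rmult_le_pos; try assumption; [lra|].
  apply Rmult_le_pos; lra.
Qed.

Lemma euler_tail_step (M : R) (k : nat) : M * (1 / 4) ^ S k = euler_tail M k - euler_tail M (S k).
Proof. unfold euler_tail. simpl. field. Qed.

Lemma defect_tail_step (M : R) (k : nat) :
  M * (INR k / 2) * (1 / 4) ^ S k = defect_tail M k - defect_tail M (S k).
Proof. unfold defect_tail. rewrite S_INR. simpl. field. Qed.

Lemma euler_tail_bound (t : nat -> C) (M : R) (z : C) (j L : nat) :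
  0 <= M -> Cmod z = 1 / 4 -> (j <= L)%nat -> (forall k, INR k * Cmod (t k) <= M) ->
  Cmod (euler t L z - euler t j z) <= euler_tail M j.
Proof.
  intros HM Hz HL Ht. unfold euler.
  replace (_ - _)%C with
    (sum_n (fun k => INR k * (t k * z ^ k))%C L - sum_n (fun k => INR k * (t k * z ^ k))%C j)%C by sum_ring.
  apply telescoping_tail; [exact HL|intros; apply tails_nonneg, HM|].
  intros k _. rewrite <- euler_tail_step, !Cmod_mult, Cmod_INR, Cmod_pow, Hz, <- Rmult_assoc.
  apply Rmult_le_compat_r; [apply pow_le; lra|apply Ht].
Qed.

Lemma defect_tail_bound (t : nat -> C) (M : R) (z w : C) (j L : nat) :
  0 <= M -> Cmod z = 1 / 4 -> Cmod w <= 1 -> (j <= L)%nat -> (forall k, INR k * Cmod (t k) <= M) ->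
  Cmod (defect t L z w - defect t j z w) <= defect_tail M j.
Proof.
  intros HM Hz Hw HL Ht. unfold defect.
  apply telescoping_tail; [exact HL|intros; apply tails_nonneg, HM|].
  intros k _. rewrite <- defect_tail_step, !Cmod_mult, Cmod_pow, Hz.
  assert (Hp : 0 <= (1 / 4) ^ S k) by (apply pow_le; lra).
  assert (Hq := qpow_bound w (S k) Hw). assert (Htk := Ht (S k)).
  assert (H0 := Cmod_ge_0 (t (S k))). assert (Hk := pos_INR k).
  (* One factor [k+1] of the bound [(k+1) k / 2] is absorbed by the coefficient bound, leaving the
     weight [k/2]. *)
  replace (INR (S k) * (INR (S k) - 1) / 2) with (INR (S k) * (INR k / 2)) in Hq
    by (rewrite S_INR; field).
  apply Rle_trans with (Cmod (t (S k)) * (1 / 4) ^ S k * (INR (S k) * (INR k / 2))).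
  - apply Rmult_le_compat_l; [apply Rmult_le_pos; assumption|exact Hq].
  - replace (_ * _) with ((INR (S k) * Cmod (t (S k))) * (INR k / 2) * (1 / 4) ^ S k) by ring.
    apply Rmult_le_compat_r; [exact Hp|]. apply Rmult_le_compat_r; [lra|exact Htk].
Qed.

Lemma Cmod_of_diff (u v : C) (e : R) :
  Cmod (u - v) <= e -> Cmod u <= Cmod v + e /\ Cmod v - e <= Cmod u.
Proof.
  intros H. assert (H1 := Cmod_triangle v (u - v)). assert (H2 := Cmod_minus_le v (u - v)).
  replace (v + (u - v))%C with u in * by ring. lra.
Qed.

(** With coefficient bound 1 the crude tails suffice: [|euler| >= 1/4 - 1/12 = 1/6], while
    [2 |defect| <= 1/9]. *)
Lemma supporting_of_small (t : nat -> C) (L : nat) :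
  (1 <= L)%nat -> t 0%nat = 0 -> t 1%nat = 0 -> (forall k, INR k * Cmod (t k) <= 1) ->
  supporting t L (1 / 4).
Proof.
  intros HL H0 H1 Ht z w Hz Hw.
  assert (HE := euler_tail_bound t 1 z 1 L Rle_0_1 Hz HL Ht).
  assert (HD := defect_tail_bound t 1 z w 1 L Rle_0_1 Hz Hw HL Ht).
  apply Cmod_of_diff in HE. apply Cmod_of_diff in HD.
  replace (euler t 1 z) with z in HE
    by (unfold euler; rewrite Csum_n_S, sum_O, H0, H1; sum_ring).
  replace (defect t 1 z w) with (RtoC 0) in HD
    by (unfold defect; rewrite Csum_n_S, sum_O, H0, H1; sum_ring).
  rewrite Cmod_0 in HD. rewrite Hz in HE.
  unfold euler_tail in HE. unfold defect_tail in HD. simpl in HE, HD. lra.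
Qed.

(** With coefficient bound 2 the crude tails fail ([1/12] against [2/9]). The terms of degree 2 and
    3 are therefore kept exactly and compared by [caratheodory_margin]; only degrees from 4 on are
    estimated by tails. *)
Lemma supporting_of_caratheodory (t : nat -> C) (L : nat) :
  (3 <= L)%nat -> t 0%nat = 0 -> t 1%nat = 0 -> (forall k, INR k * Cmod (t k) <= 2) ->
  Cmod (3 * t 3%nat - (2 * t 2%nat) * (2 * t 2%nat) / 2) <= 2 - Cmod (2 * t 2%nat) ^ 2 / 2 ->
  supporting t L (1 / 4).
Proof.
  intros HL H0 H1 Ht HC z w Hz Hw.
  assert (HE := euler_tail_bound t 2 z 3 L (Rlt_le _ _ Rlt_0_2) Hz HL Ht).
  assert (HD := defect_tail_bound t 2 z w 3 L (Rlt_le _ _ Rlt_0_2) Hz Hw HL Ht).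
  apply Cmod_of_diff in HE. apply Cmod_of_diff in HD.
  pose (x := (2 * t 2%nat * z)%C). pose (X := (3 * t 3%nat * (z * z))%C).
  replace (euler t 3 z) with (z * (1 + x + X))%C in HE.
  2: { unfold euler, x, X. rewrite !Csum_n_S, sum_O, H0, H1. simpl.
       rewrite !RtoC_plus. sum_ring. }
  replace (defect t 3 z w) with (z * (x + 2 * X * (2 + w) / 3) / 2)%C in HD.
  2: { unfold defect, x, X. rewrite !Csum_n_S, sum_O, H0, H1. simpl.
       rewrite !RtoC_plus. match goal with |- @eq _ ?a ?b => change (@eq C a b); field end. }
  assert (Hm : Cmod (x + 2 * X * (2 + w) / 3) + 13 / 72 < Cmod (1 + x + X)).
  (* The hypothesis is multiplied by [|z|^2 = 1/16], which turns the constant 2 into [1/8]. *)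
  { apply caratheodory_margin; [|exact Hw].
    unfold x, X. replace (_ - _)%C with ((3 * t 3%nat - (2 * t 2%nat) * (2 * t 2%nat) / 2) * (z * z))%C by field.
    rewrite (Cmod_mult _ (z * z)), (Cmod_mult z z), (Cmod_mult _ z), Hz. lra. }
  rewrite Cmod_div, !(Cmod_mult z), Hz, (Cmod_R 2), (Rabs_pos_eq 2) in HD
    by (try lra; intros E; apply RtoC_inj in E; lra).
  rewrite Cmod_mult, Hz in HE.
  unfold euler_tail in HE. unfold defect_tail in HD. simpl in HE, HD. lra.
Qed.

(** The sum is at most [2 (1/4 + 1/16 + ...) = 2/3]. *)
Lemma deriv_majorant_add_lt (A B : nat -> C) (L : nat) :
  (1 <= L)%nat -> A 1%nat = 0 -> B 1%nat = 0 ->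
  (forall k, INR k * (Cmod (A k) + Cmod (B k)) <= 2) ->
  deriv_majorant A L (1 / 4) + deriv_majorant B L (1 / 4) < 1.
Proof.
  intros HL HA HB H. unfold deriv_majorant.
  pose (u := fun k => INR k * (Cmod (A k) + Cmod (B k)) * (1 / 4) ^ pred k).
  replace (_ + _) with (sum_n u L).
  2: { clear HL. induction L as [|L IH]; [rewrite !sum_O; unfold u; simpl; sum_ring|].
       rewrite !Rsum_n_S, IH. unfold u. sum_ring. }
  assert (Hs : sum_n u L <= sum_n u 1 + 4 * euler_tail 2 1).
  { apply sum_n_telescoping with (G := fun k => 4 * euler_tail 2 k); [exact HL| |].
    - intros k. generalize (tails_nonneg 2 k). lra.
    - intros k _. rewrite <- Rmult_minus_distr_l, <- euler_tail_step.
      unfold u. change (pred (S k)) with k.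
      assert (Hp : 0 <= (1 / 4) ^ k) by (apply pow_le; lra).
      generalize (Rmult_le_compat_r _ _ _ Hp (H (S k))). rewrite <- tech_pow_Rmult. lra. }
  rewrite Rsum_n_S, sum_O in Hs. unfold u in Hs at 2 3. rewrite HA, HB, Cmod_0 in Hs.
  unfold euler_tail in Hs. simpl in Hs. lra.
Qed.

Lemma Cmod_lin_le (A B c : C) : Cmod c = 1 -> Cmod (A + c * B) <= Cmod A + Cmod B.
Proof.
  intros Hc. eapply Rle_trans; [apply Cmod_triangle|]. rewrite Cmod_mult, Hc. lra.
Qed.

(** The case [p = 1]: every rotation [c * B] satisfies the bound 1, so [supporting_of_small]
    applies. *)
Lemma convex_harmonic_identity_analytic (A B : nat -> C) (L : nat) :
  (1 <= L)%nat -> (forall k, A k = 0) -> B 0%nat = 0 -> B 1%nat = 0 ->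
  (forall k, INR k * Cmod (B k) <= 1) -> convex_harmonic_on_disk (harm A B L) (1 / 4).
Proof.
  intros HL HA HB0 HB1 HB. apply convex_harmonic_of_supporting; [lra| |].
  - apply deriv_majorant_add_lt; try assumption; [apply HA|].
    intros k. rewrite HA, Cmod_0. generalize (HB k). lra.
  - intros c Hc. apply supporting_of_small; [exact HL|rewrite HA, HB0; ring|rewrite HA, HB1; ring|].
    intros k. rewrite HA. replace (0 + c * B k)%C with (c * B k)%C by ring.
    rewrite Cmod_mult, Hc, Rmult_1_l. apply HB.
Qed.

Lemma convex_harmonic_of_caratheodory (A B : nat -> C) (L : nat) :
  (3 <= L)%nat -> A 0%nat = 0 -> A 1%nat = 0 -> B 0%nat = 0 -> B 1%nat = 0 ->
  (forall k, INR k * (Cmod (A k) + Cmod (B k)) <= 2) ->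
  (forall c : C, Cmod c = 1 ->
     let t := fun k => (A k + c * B k)%C in
     Cmod (3 * t 3%nat - (2 * t 2%nat) * (2 * t 2%nat) / 2) <= 2 - Cmod (2 * t 2%nat) ^ 2 / 2) ->
  convex_harmonic_on_disk (harm A B L) (1 / 4).
Proof.
  intros HL HA0 HA1 HB0 HB1 H2 HC. apply convex_harmonic_of_supporting; [lra| |].
  - apply deriv_majorant_add_lt; try assumption. lia.
  - intros c Hc. apply supporting_of_caratheodory;
      [exact HL|rewrite HA0, HB0; ring|rewrite HA1, HB1; ring| |exact (HC c Hc)].
    intros k. eapply Rle_trans; [|apply (H2 k)].
    apply Rmult_le_compat_l; [apply pos_INR|apply Cmod_lin_le, Hc].
Qed.

(** * Power series expansions *)

(* Stating the expansion through all real-linear functionals [Re (l * _)] gives access to the real power series of Coquelicot. *)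
Definition has_expansion (c : nat -> C) (f : C -> C) : Prop :=
  forall z l : C, 0 < Cmod z < 1 ->
    is_series (fun n => Re (l * (c n * z ^ n))) (Re (l * f z)).

Lemma is_series_R_ext (a b : nat -> R) (la lb : R) :
  (forall n, a n = b n) -> la = lb -> is_series a la -> is_series b lb.
Proof. intros H <-. apply is_series_ext, H. Qed.

Lemma has_expansion_ext (c d : nat -> C) (f g : C -> C) :
  (forall n, c n = d n) -> (forall z, 0 < Cmod z < 1 -> f z = g z) ->
  has_expansion c f -> has_expansion d g.
Proof.
  intros Hc Hf H z l Hz. apply (is_series_R_ext _ _ _ _ (fun n => f_equal (fun x => Re (l * (x * z ^ n))) (Hc n))
    (f_equal (fun x => Re (l * x)) (Hf z Hz)) (H z l Hz)).
Qed.

Lemma has_expansion_lin (c d : nat -> C) (f g : C -> C) (s : C) :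
  has_expansion c f -> has_expansion d g ->
  has_expansion (fun n => c n + s * d n)%C (fun z => f z + s * g z)%C.
Proof.
  intros Hf Hg z l Hz.
  refine (is_series_R_ext _ _ _ _ _ _ (is_series_plus _ _ _ _ (Hf z l Hz) (Hg z (l * s)%C Hz))).
  - intros n. change plus with Rplus; cbv beta. rewrite <- re_plus. f_equal. ring.
  - change plus with Rplus; cbv beta. rewrite <- re_plus. f_equal. ring.
Qed.

(** Expansions are tested only off the origin, so the functional [l / z] is available and shifts the
    series by one index. *)
Lemma has_expansion_div (c : nat -> C) (f g : C -> C) :
  has_expansion c f -> c O = 0 -> (forall z, 0 < Cmod z < 1 -> f z = (z * g z)%C) ->
  has_expansion (fun n => c (S n)) g.
Proof.
  intros Hf H0 Hg z l Hz.
  assert (Hz0 : z <> 0%C) by (apply Cmod_gt_0; lra).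
  refine (is_series_R_ext _ _ _ _ _ eq_refl (is_series_incr_1 (fun n => Re (l / z * (c n * z ^ n))) _ _)).
  - intros n. cbv beta. simpl Cpow. f_equal. field. exact Hz0.
  - refine (is_series_R_ext _ _ _ _ (fun n => eq_refl) _ (Hf z (l / z)%C Hz)).
    rewrite (Hg z Hz), H0. change plus with Rplus; simpl Cpow. rewrite Cmult_0_l, Cmult_0_r.
    change (Re 0) with 0. rewrite Rplus_0_r. f_equal. field. exact Hz0.
Qed.

Lemma ex_pseries_CV_radius (a : nat -> R) (x : R) : ex_pseries a x -> Rbar_le (Rabs x) (CV_radius a).
Proof.
  intros [l Hl]. apply Rbar_not_lt_le. intros H. apply (CV_disk_outside a x H).
  apply ex_series_lim_0. exists l. apply is_pseries_R. exact Hl.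
Qed.

Lemma RtoC_pow_mult (t : R) (z : C) (n : nat) : ((t * z) ^ n = RtoC (t ^ n) * z ^ n)%C.
Proof. rewrite Cpow_mult_l, RtoC_pow. reflexivity. Qed.

(** Along the ray through [z] the expansion becomes a real power series in [t], to which termwise
    differentiation applies. *)
Lemma has_expansion_ray (c : nat -> C) (f : C -> C) (z l : C) (t : R) :
  has_expansion c f -> 0 < t -> 0 < Cmod z -> t * Cmod z < 1 ->
  is_pseries (fun n => Re (l * (c n * z ^ n))) t (Re (l * f (t * z)%C)).
Proof.
  intros Hf Ht Hz Htz. apply is_pseries_R.
  refine (is_series_R_ext _ _ _ _ _ eq_refl (Hf (t * z)%C l _)).
  - intros n. simpl. rewrite RtoC_pow_mult. unfold Re; simpl. ring.
  - rewrite Cmod_mult, Cmod_R, Rabs_pos_eq by lra. nra.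
Qed.

Lemma has_expansion_CV_radius (c : nat -> C) (f : C -> C) (z l : C) (t : R) :
  has_expansion c f -> 0 <= t -> 0 < Cmod z -> t * Cmod z < 1 ->
  Rbar_lt (Rabs t) (CV_radius (fun n => Re (l * (c n * z ^ n)))).
Proof.
  intros Hf Ht Hz Htz.
  (* The midpoint of [t] and [1 / |z|]: the series still converges at [s > t], so [t] is strictly
     inside the radius. *)
  pose (s := (t + / Cmod z) / 2).
  assert (H1 : / Cmod z * Cmod z = 1) by (field; lra).
  assert (H2 : 0 < / Cmod z) by (apply Rinv_0_lt_compat; lra).
  assert (H3 : t < / Cmod z) by (apply (Rmult_lt_reg_r (Cmod z)); lra).
  apply Rbar_lt_le_trans with (Rabs s).
  - simpl. rewrite !Rabs_pos_eq; unfold s; lra.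
  - apply ex_pseries_CV_radius. eexists. apply (has_expansion_ray c f z l s Hf); unfold s; nra.
Qed.

Lemma is_derive_ray (f : C -> C) (z l d : C) :
  has_cderiv f z d -> is_derive (fun t : R => Re (l * f (t * z)%C)) 1 (Re (l * (z * d))).
Proof.
  intros Hd. apply is_derive_Reals. intros eps Heps.
  (* The summand 1 keeps [K] positive and turns the non-strict estimate of [has_cderiv] into a
     strict one. *)
  pose (K := Cmod l * Cmod z + 1).
  assert (HK : 0 < K) by (generalize (Cmod_ge_0 l) (Cmod_ge_0 z); unfold K; nra).
  destruct (Hd (eps / K)) as [delta [Hdelta H]]; [apply Rdiv_lt_0_compat; assumption|].
  assert (Hz1 : 0 < Cmod z + 1) by (generalize (Cmod_ge_0 z); lra).
  exists (mkposreal (delta / (Cmod z + 1)) (Rdiv_lt_0_compat _ _ Hdelta Hz1)).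
  intros h Hh0 Hh. simpl in Hh.
  assert (Enorm : forall v, Cnorm v = Cmod v) by (intros; unfold Cnorm, Cmod; f_equal; ring).
  specialize (H ((1 + h)%R * z)%C).
  assert (Ed : Csub ((1 + h)%R * z)%C z = (h * z)%C).
  { change (((1 + h)%R * z - z)%C = (h * z)%C). rewrite RtoC_plus. ring. }
  rewrite Ed, !Enorm, Cmod_mult, Cmod_R in H.
  assert (Hlt : Rabs h * Cmod z < delta).
  { apply (Rmult_lt_compat_r (Cmod z + 1)) in Hh; [|lra].
    unfold Rdiv in Hh. rewrite Rmult_assoc, Rinv_l in Hh by lra.
    generalize (Rabs_pos h); nra. }
  specialize (H Hlt). rewrite Cmult_1_l.
  set (e := Csub _ _) in H.
  assert (Ee : Re (l * f ((1 + h)%R * z)%C) - Re (l * f z) = h * Re (l * (z * d)) + Re (l * e)).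
  { unfold e, Re, Csub, Cadd, Defs.Copp, Cmul; simpl. ring. }
  replace ((_ - _) / h - _) with (Re (l * e) / h) by (rewrite Ee; field; exact Hh0).
  assert (Hh1 : 0 < Rabs h) by (apply Rabs_pos_lt; exact Hh0).
  unfold Rdiv at 1. rewrite Rabs_mult, Rabs_inv.
  apply (Rmult_lt_reg_r (Rabs h)); [exact Hh1|].
  rewrite Rmult_assoc, Rinv_l, Rmult_1_r by lra.
  apply Rle_lt_trans with (Cmod l * Cmod e); [rewrite <- Cmod_mult; apply re_le_Cmod|].
  apply Rle_lt_trans with (Cmod l * (eps / K * (Rabs h * Cmod z))).
  - apply Rmult_le_compat_l; [apply Cmod_ge_0|exact H].
  - apply Rlt_le_trans with (eps / K * (Rabs h * K)).
    + replace (Cmod l * _) with (eps / K * Rabs h * (Cmod l * Cmod z)) by ring.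
      replace (eps / K * (Rabs h * K)) with (eps / K * Rabs h * K) by ring.
      apply Rmult_lt_compat_l; [|unfold K; lra].
      apply Rmult_lt_0_compat; [apply Rdiv_lt_0_compat|]; lra.
    + right. field. lra.
Qed.

(** The real power series along the ray is differentiated termwise at [t = 1], which is inside its
    radius since [|z| < 1]. The chain rule produces the factor [z], so indices stay unshifted. *)
Lemma has_expansion_deriv (c : nat -> C) (f f1 : C -> C) :
  has_expansion c f -> (forall z, Cmod z < 1 -> has_cderiv f z (f1 z)) ->
  has_expansion (fun n => INR n * c n)%C (fun z => z * f1 z)%C.
Proof.
  intros Hf Hd z l Hz.
  pose (a := fun n => Re (l * (c n * z ^ n))).
  assert (HCV : Rbar_lt (Rabs 1) (CV_radius a)).
  { apply (has_expansion_CV_radius c f); [exact Hf|lra..]. }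
  assert (HD : is_derive (PSeries a) 1 (Re (l * (z * f1 z)))).
  { apply is_derive_ext_loc with (f := fun t : R => Re (l * f (t * z)%C));
      [|apply is_derive_ray, Hd; lra].
    assert (H1 : 0 < / Cmod z - 1).
    { apply (Rmult_lt_reg_r (Cmod z)); [lra|].
      replace ((/ Cmod z - 1) * Cmod z) with (1 - Cmod z) by (field; lra). lra. }
    assert (H2 : 0 < Rmin 1 (/ Cmod z - 1)) by (apply Rmin_pos; lra).
    exists (mkposreal _ H2). intros t Ht.
    assert (Ht' : Rabs (t - 1) < Rmin 1 (/ Cmod z - 1)) by exact Ht.
    apply Rabs_def2 in Ht'. destruct Ht' as [Ht1 Ht2].
    generalize (Rmin_l 1 (/ Cmod z - 1)) (Rmin_r 1 (/ Cmod z - 1)); intros H3 H4.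
    symmetry. apply is_pseries_unique, (has_expansion_ray c f); [exact Hf|lra|lra|].
    replace 1 with (/ Cmod z * Cmod z) by (field; lra).
    apply Rmult_lt_compat_r; lra. }
  assert (HS := is_pseries_derive a 1 HCV).
  rewrite (is_derive_unique _ _ _ HD) in HS. apply is_pseries_R in HS.
  refine (is_series_R_ext _ _ _ _ _ _ (is_series_decr_1 (fun n => INR n * a n) _ _)).
  - intros n. unfold a, Re; simpl. ring.
  - reflexivity.
  - refine (is_series_R_ext _ _ _ _ _ _ HS).
    + intros n. unfold PS_derive. rewrite pow1. sum_ring.
    + unfold plus, opp; simpl. sum_ring.
Qed.

(** * From list sums to real series *)

Lemma fold_right_Cadd (l : list Cx) (c : C) :
  fold_right Cadd c l = (fold_right Cadd Defs.C0 l + c)%C.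
Proof.
  induction l as [|x l IH]; simpl; [change Defs.C0 with (RtoC 0); sum_ring|].
  rewrite IH. change (Cadd x (fold_right Cadd Defs.C0 l + c)%C) with (x + (fold_right Cadd Defs.C0 l + c))%C.
  change (Cadd x (fold_right Cadd Defs.C0 l)) with (x + fold_right Cadd Defs.C0 l)%C. sum_ring.
Qed.

Lemma fold_seq_S (u : nat -> Cx) (lo n : nat) :
  fold_right Cadd Defs.C0 (map u (seq lo (S n)))
  = (fold_right Cadd Defs.C0 (map u (seq lo n)) + u (lo + n)%nat)%C.
Proof.
  rewrite seq_S, map_app, fold_right_app, fold_right_Cadd. simpl.
  change (Cadd (u (lo + n)%nat) Defs.C0) with (u (lo + n)%nat + 0)%C. sum_ring.
Qed.

Lemma Csum_0 (u : nat -> Cx) (n : nat) : Csum u 0 n = sum_n (u : nat -> C) n.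
Proof.
  unfold Csum. rewrite Nat.sub_0_r.
  induction n as [|n IH].
  - rewrite fold_seq_S, sum_O. simpl. change Defs.C0 with (RtoC 0). sum_ring.
  - rewrite fold_seq_S, IH, Csum_n_S. reflexivity.
Qed.

Lemma Re_sum_n (u : nat -> C) (l : C) (n : nat) :
  Re (l * sum_n u n) = sum_n (fun k => Re (l * u k)) n.
Proof.
  induction n as [|n IH]; [rewrite !sum_O; reflexivity|].
  rewrite Csum_n_S, Rsum_n_S, <- IH, <- re_plus. f_equal. sum_ring.
Qed.

Lemma Cseries_is_series (u : nat -> C) (s l : C) :
  Cseries u s -> is_series (fun n => Re (l * u n)) (Re (l * s)).
Proof.
  intros H. change (is_lim_seq (sum_n (fun n => Re (l * u n))) (Re (l * s))).
  apply is_lim_seq_spec. intros eps.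
  assert (HK : 0 < Cmod l + 1) by (generalize (Cmod_ge_0 l); lra).
  destruct (H (eps / (Cmod l + 1))) as [N HN]; [apply Rdiv_lt_0_compat; [apply cond_pos|exact HK]|].
  exists N. intros n Hn. specialize (HN n Hn). rewrite Csum_0 in HN.
  rewrite <- Re_sum_n.
  replace (Re (l * sum_n u n) - Re (l * s)) with (Re (l * (sum_n u n - s)))
    by (unfold Re; simpl; ring).
  eapply Rle_lt_trans; [apply re_le_Cmod|]. rewrite Cmod_mult.
  assert (E : Cnorm (Csub (sum_n u n) s) = Cmod (sum_n u n - s)) by (unfold Cnorm, Cmod; f_equal; simpl; ring).
  rewrite E in HN.
  apply Rle_lt_trans with ((Cmod l + 1) * Cmod (sum_n u n - s)).
  - generalize (Cmod_ge_0 (sum_n u n - s)). nra.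
  - apply (Rmult_lt_compat_l (Cmod l + 1)) in HN; [|exact HK].
    replace ((Cmod l + 1) * (eps / (Cmod l + 1))) with (pos eps) in HN by (field; lra). exact HN.
Qed.

Lemma has_expansion_of_Cseries (a c : nat -> C) (f : C -> C) :
  c O = 0 -> (forall n, c (n + 2)%nat = a (n + 2)%nat) ->
  (forall z, Cmod z < 1 -> Cseries (fun n => Cmul (a (n + 2)%nat) (Defs.Cpow z (n + 2))) (f z - c 1%nat * z)%C) ->
  has_expansion c f.
Proof.
  intros H0 Hc Hs z l Hz.
  apply is_series_decr_1, is_series_decr_1.
  refine (is_series_R_ext _ _ _ _ _ _ (Cseries_is_series _ _ l (Hs z (proj2 Hz)))).
  - intros n. simpl. rewrite <- Hc. replace (n + 2)%nat with (S (S n)) by lia. reflexivity.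
  - rewrite H0. unfold plus, opp, Re; simpl. ring.
Qed.

(** * Fourier coefficients *)

Definition cis (x : R) : C := (cos x, sin x).

Lemma cis_plus (x y : R) : cis (x + y) = (cis x * cis y)%C.
Proof. unfold cis. rewrite cos_plus, sin_plus. apply injective_projections; simpl; ring. Qed.

Lemma Cmod_cis (x : R) : Cmod (cis x) = 1.
Proof.
  unfold Cmod, cis; simpl. replace (_ + _) with 1; [apply sqrt_1|].
  generalize (sin2_cos2 x). unfold Rsqr. lra.
Qed.

Lemma cis_pow (x : R) (n : nat) : (cis x ^ n)%C = cis (INR n * x).
Proof.
  induction n as [|n IH].
  - simpl. rewrite Rmult_0_l. unfold cis. rewrite cos_0, sin_0. reflexivity.
  - rewrite S_INR, Rmult_plus_distr_r, Rmult_1_l, Rplus_comm, cis_plus. simpl. rewrite IH. reflexivity.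
Qed.

(** Orthogonality of the exponentials. *)
Lemma is_RInt_cis (s : C) (m : Z) :
  is_RInt (fun x => Re (s * cis (IZR m * x))) 0 (2 * PI)
    (if Z.eq_dec m 0 then 2 * PI * Re s else 0).
Proof.
  destruct (Z.eq_dec m 0) as [->|Hm].
  - apply is_RInt_ext with (f := fun _ => Re s).
    + intros x _. rewrite Rmult_0_l. unfold cis. rewrite cos_0, sin_0. unfold Re; simpl. ring.
    + replace (2 * PI * Re s) with (scal (2 * PI - 0) (Re s)) by (unfold scal; simpl; unfold mult; simpl; ring).
      apply (@is_RInt_const R_NormedModule).
  - assert (Hm' : IZR m <> 0) by (apply not_0_IZR; exact Hm).
    pose (F := fun x => (Re s * sin (IZR m * x) + Im s * cos (IZR m * x)) / IZR m).
    replace 0 with (minus (F (2 * PI)) (F 0)) at 2.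
    2: { unfold F, minus, plus, opp; simpl.
         assert (E0 : sin (IZR m * PI) = 0) by (apply sin_eq_0_1; exists m; reflexivity).
         assert (E1 : cos (IZR m * (2 * PI)) = 1).
         { replace (IZR m * (2 * PI)) with (2 * (IZR m * PI)) by ring. rewrite cos_2a_sin, E0. ring. }
         assert (E2 : sin (IZR m * (2 * PI)) = 0).
         { replace (IZR m * (2 * PI)) with (2 * (IZR m * PI)) by ring. rewrite sin_2a, E0. ring. }
         rewrite E1, E2, (Rmult_0_r (IZR m)), sin_0, cos_0. ring. }
    apply (is_RInt_derive F).
    + intros x _. unfold F. auto_derive; [exact I|]. unfold cis, Re, Im; simpl. field. exact Hm'.
    + intros x _. apply continuity_pt_filterlim. unfold cis, Re; simpl. reg.
Qed.

Lemma is_RInt_sum_n (u : nat -> R -> R) (v : nat -> R) (a b : R) (n : nat) :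
  (forall k, is_RInt (u k) a b (v k)) ->
  is_RInt (fun x => sum_n (fun k => u k x) n) a b (sum_n v n).
Proof.
  intros H. induction n as [|n IH].
  - rewrite sum_O. apply is_RInt_ext with (f := u O); [intros; rewrite sum_O; reflexivity|apply H].
  - rewrite sum_Sn. apply is_RInt_ext with (f := fun x => plus (sum_n (fun k => u k x) n) (u (S n) x)).
    + intros; rewrite sum_Sn; reflexivity.
    + apply (is_RInt_plus (V := R_NormedModule)); [exact IH|apply H].
Qed.

(** Weierstrass M-test with an error term that depends only on [K], hence uniform when [u] depends
    on a parameter. *)
Lemma weierstrass_tail (u : nat -> R) (K : nat -> R) (l : R) (n : nat) :
  is_series u l -> ex_series K -> (forall k, Rabs (u k) <= K k) ->
  Rabs (sum_n u n - l) <= Series K - sum_n K n.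
Proof.
  intros Hu HK Hle.
  assert (H : forall N, (n <= N)%nat -> Rabs (sum_n u N - sum_n u n) <= sum_n K N - sum_n K n).
  { intros N HN. induction HN as [|N HN IH].
    - rewrite !Rminus_diag, Rabs_R0. lra.
    - rewrite !Rsum_n_S. generalize (Hle (S N)).
      replace (sum_n u N + u (S N) - sum_n u n) with ((sum_n u N - sum_n u n) + u (S N)) by ring.
      generalize (Rabs_triang (sum_n u N - sum_n u n) (u (S N))). lra. }
  rewrite Rabs_minus_sym.
  change (Rbar_le (Rabs (l - sum_n u n)) (Series K - sum_n K n)).
  apply (is_lim_seq_le_loc (fun N => Rabs (sum_n u N - sum_n u n)) (fun N => sum_n K N - sum_n K n)).
  - exists n. exact H.
  - apply (is_lim_seq_abs (fun N => sum_n u N - sum_n u n) (l - sum_n u n)).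
    apply is_lim_seq_minus'; [exact Hu|apply is_lim_seq_const].
  - apply is_lim_seq_minus'; [exact (Series_correct K HK)|apply is_lim_seq_const].
Qed.

(** Convergence on the ray through [(1 + r) / 2] is absolute at modulus [r]. The functionals [1] and
    [-i] give the real and imaginary parts of the coefficients. *)
Lemma has_expansion_abs (c : nat -> C) (f : C -> C) (r : R) :
  has_expansion c f -> 0 < r < 1 -> ex_series (fun n => Cmod (c n) * r ^ n).
Proof.
  intros Hf Hr.
  assert (H : forall l : C, ex_series (fun n => Rabs (Re (l * c n)) * r ^ n)).
  { intros l. pose (z := RtoC ((1 + r) / 2)).
    assert (Hz : Cmod z = (1 + r) / 2) by (unfold z; rewrite Cmod_R; apply Rabs_pos_eq; lra).
    pose (t := r / ((1 + r) / 2)).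
    assert (Et : t * ((1 + r) / 2) = r) by (unfold t; field; lra).
    assert (Ht : 0 < t) by (apply Rdiv_lt_0_compat; lra).
    assert (HCV : Rbar_lt (Rabs t) (CV_radius (fun n => Re (l * (c n * z ^ n))))).
    { apply (has_expansion_CV_radius c f); [exact Hf|lra| |]; rewrite Hz; lra. }
    apply CV_disk_inside in HCV. revert HCV. apply ex_series_ext. intros n.
    assert (En : r ^ n = t ^ n * ((1 + r) / 2) ^ n) by (rewrite <- Rpow_mult_distr, Et; reflexivity).
    unfold z. rewrite <- RtoC_pow, En.
    replace (Re _ * _) with (Re (l * c n) * (t ^ n * ((1 + r) / 2) ^ n)) by (unfold Re; simpl; ring).
    rewrite Rabs_mult, (Rabs_pos_eq (_ * _)); [reflexivity|].
    apply Rmult_le_pos; apply pow_le; lra. }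
  apply @ex_series_le with (b := fun n => Rabs (Re (1 * c n)) * r ^ n + Rabs (Re (- Ci * c n)) * r ^ n).
  - intros n. assert (Hp : 0 <= r ^ n) by (apply pow_le; lra).
    change (norm (Cmod (c n) * r ^ n)) with (Rabs (Cmod (c n) * r ^ n)).
    rewrite Rabs_pos_eq by (apply Rmult_le_pos; [apply Cmod_ge_0|exact Hp]).
    rewrite <- Rmult_plus_distr_r. apply Rmult_le_compat_r; [exact Hp|].
    eapply Rle_trans; [apply Cmod_le_abs|]. right. f_equal; f_equal; unfold Re, Im; simpl; ring.
  - apply @ex_series_plus with (V := R_NormedModule); apply H.
Qed.

Definition fourier_term (c : nat -> C) (r : R) (s : C) (k : Z) (n : nat) : R :=
  if Z.eq_dec (k + Z.of_nat n) 0 then 2 * PI * Re (s * (c n * r ^ n)) else 0.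

(** The expansion converges uniformly on the circle, so it is integrated termwise; the limit theorem
    also supplies the integrability of [f] there. *)
Lemma fourier_integral (c : nat -> C) (f : C -> C) (r : R) (s : C) (k : Z) :
  has_expansion c f -> 0 < r < 1 ->
  exists I : R, is_series (fourier_term c r s k) I /\
    is_RInt (fun x => Re (s * cis (IZR k * x) * f (r * cis x)%C)) 0 (2 * PI) I.
Proof.
  intros Hf Hr.
  pose (u := fun (n : nat) (x : R) => Re (s * cis (IZR k * x) * (c n * (r * cis x) ^ n))).
  pose (g := fun x => Re (s * cis (IZR k * x) * f (r * cis x)%C)).
  assert (Hu : forall x, is_series (fun n => u n x) (g x)).
  { intros x. apply Hf. rewrite Cmod_mult, Cmod_cis, Cmod_R, Rabs_pos_eq; lra. }
  assert (Hint : forall n, is_RInt (u n) 0 (2 * PI) (fourier_term c r s k n)).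
  { intros n. unfold fourier_term.
    apply is_RInt_ext with (f := fun x => Re (s * (c n * r ^ n) * cis (IZR (k + Z.of_nat n) * x))).
    - intros x _. unfold u.
      rewrite RtoC_pow_mult, cis_pow, plus_IZR, <- INR_IZR_INZ, Rmult_plus_distr_r, cis_plus, RtoC_pow.
      f_equal. ring.
    - apply is_RInt_cis. }
  destruct (filterlim_RInt (V := R_CompleteNormedModule) (fun N x => sum_n (fun n => u n x) N) 0 (2 * PI)
    eventually eventually_filter g (sum_n (fourier_term c r s k))) as [I [H1 H2]].
  - intros N. apply is_RInt_sum_n, Hint.
  - apply filterlim_locally. intros eps.
    pose (K := fun n => Cmod s * (Cmod (c n) * r ^ n)).
    assert (HK : ex_series K).
    { apply (ex_series_scal_l (V := R_NormedModule) (Cmod s) (fun n => Cmod (c n) * r ^ n)). apply (has_expansion_abs c f); assumption. }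
    destruct (proj2 (is_lim_seq_spec (sum_n K) (Series K)) (Series_correct K HK) eps) as [N HN].
    exists N. intros n Hn x. change (Rabs (sum_n (fun n => u n x) n - g x) < eps).
    eapply Rle_lt_trans; [apply (weierstrass_tail (fun n => u n x) K); [apply Hu|exact HK|]|].
    + intros j. unfold u, K. eapply Rle_trans; [apply re_le_Cmod|].
      rewrite !Cmod_mult, Cmod_pow, Cmod_mult, !Cmod_cis, Cmod_R, Rabs_pos_eq by lra.
      rewrite !Rmult_1_r. apply Rle_refl.
    + generalize (HN n Hn). rewrite Rabs_minus_sym. intros H. eapply Rle_lt_trans; [apply Rle_abs|exact H].
  - exists I. split; assumption.
Qed.

Lemma is_series_single (a : nat -> R) (m : nat) :
  (forall n, n <> m -> a n = 0) -> is_series a (a m).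
Proof.
  intros H. change (is_lim_seq (sum_n a) (a m)).
  apply is_lim_seq_ext_loc with (u := fun _ => a m); [|apply is_lim_seq_const].
  assert (H0 : forall n, (n < m)%nat -> sum_n a n = 0).
  { induction n as [|n IH]; intros Hn; [rewrite sum_O; apply H; lia|].
    rewrite Rsum_n_S, IH, H by lia. sum_ring. }
  exists m. intros n Hn. symmetry. induction Hn as [|n Hn IH].
  - destruct m as [|m]; [apply sum_O|]. rewrite Rsum_n_S, H0 by lia. sum_ring.
  - rewrite Rsum_n_S, IH, (H (S n)) by lia. sum_ring.
Qed.

Lemma fourier_coef (c : nat -> C) (f : C -> C) (r : R) (s : C) (m : nat) :
  has_expansion c f -> 0 < r < 1 ->
  is_RInt (fun x => Re (s * cis (- INR m * x) * f (r * cis x)%C)) 0 (2 * PI)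
    (2 * PI * Re (s * (c m * r ^ m))).
Proof.
  intros Hf Hr. destruct (fourier_integral c f r s (- Z.of_nat m) Hf Hr) as [I [H1 H2]].
  rewrite opp_IZR, <- INR_IZR_INZ in H2.
  assert (H0 : forall n, n <> m -> fourier_term c r s (- Z.of_nat m) n = 0).
  { intros n Hn. unfold fourier_term. destruct (Z.eq_dec _ 0); [lia|reflexivity]. }
  assert (H3 := is_series_single _ m H0).
  apply is_series_unique in H1, H3. rewrite H1 in H3. rewrite H3 in H2.
  unfold fourier_term in H2. destruct (Z.eq_dec _ 0) as [_|]; [exact H2|lia].
Qed.

(** The expansion has no negative frequencies, so pairing with a positive one gives 0. *)
Lemma fourier_coef_pos (c : nat -> C) (f : C -> C) (r : R) (s : C) (m : nat) :
  (1 <= m)%nat -> has_expansion c f -> 0 < r < 1 ->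
  is_RInt (fun x => Re (s * cis (INR m * x) * f (r * cis x)%C)) 0 (2 * PI) 0.
Proof.
  intros Hm Hf Hr. destruct (fourier_integral c f r s (Z.of_nat m) Hf Hr) as [I [H1 H2]].
  rewrite <- INR_IZR_INZ in H2.
  assert (H0 : forall n, fourier_term c r s (Z.of_nat m) n = 0).
  { intros n. unfold fourier_term. destruct (Z.eq_dec _ 0); [lia|reflexivity]. }
  assert (H3 := is_series_single (fourier_term c r s (Z.of_nat m)) O (fun n _ => H0 n)).
  rewrite H0 in H3. apply is_series_unique in H1, H3. rewrite H1 in H3. rewrite H3 in H2. exact H2.
Qed.

(** * The Caratheodory inequality *)

(** Lets inequalities obtained on circles of radius [r < 1] pass to [r = 1], where the powers of [r]
    disappear. *)
Lemma nonneg_at_1 (f : R -> R) :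
  continuity_pt f 1 -> (forall r, 0 < r < 1 -> 0 <= f r) -> 0 <= f 1.
Proof.
  intros Hc Hf. apply Rnot_lt_le. intros Hlt.
  destruct (Hc (- f 1)) as [d [Hd H]]; [lra|].
  pose (r := 1 - Rmin (1 / 2) (d / 2)).
  assert (H1 : 0 < Rmin (1 / 2) (d / 2)) by (apply Rmin_pos; lra).
  assert (H2 := Rmin_l (1 / 2) (d / 2)). assert (H3 := Rmin_r (1 / 2) (d / 2)).
  specialize (H r). simpl in H. unfold R_dist, D_x, no_cond in H.
  assert (Hr : Rabs (f r - f 1) < - f 1).
  { apply H. split; [split; [exact I|unfold r; lra]|].
    unfold r. rewrite Rabs_left; lra. }
  apply Rabs_def2 in Hr. generalize (Hf r). unfold r in *. lra.
Qed.

(** The sign is negative so that a nonnegative form containing [Re (conj x * d)] becomes an upper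
    bound for [|d|]. *)
Lemma unit_dual (d : C) : exists x : C, Cmod x = 1 /\ Re (Cconj x * d) = - Cmod d.
Proof.
  destruct (Req_dec (Cmod d) 0) as [E|E].
  - exists 1%C. split; [apply Cmod_1|]. rewrite E. apply Cmod_eq_0 in E. rewrite E.
    unfold Re; simpl. ring.
  - assert (E' : RtoC (Cmod d) <> 0%C) by (intros H; apply RtoC_inj in H; contradiction).
    exists (- (/ Cmod d * d))%C. split.
    + rewrite Cmod_opp, Cmod_mult, Cmod_inv, Cmod_R, Rabs_pos_eq by (try exact E'; apply Cmod_ge_0).
      field. exact E.
    + rewrite Copp_conj, Cmult_conj, <- RtoC_inv by exact E.
      replace (Cconj (RtoC (/ Cmod d))) with (RtoC (/ Cmod d))
        by (apply injective_projections; simpl; ring).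
      replace (- (/ Cmod d)%R * Cconj d * d)%C with (- ((/ Cmod d)%R * (d * Cconj d)))%C by ring.
      replace (- ((/ Cmod d)%R * Cconj d) * d)%C with (- ((/ Cmod d)%R * (d * Cconj d)))%C by ring.
      rewrite <- Cmod2_conj, re_opp. unfold Re; simpl. field. exact E.
Qed.

Lemma PI2_pos : 0 < 2 * PI.
Proof. generalize PI_RGT_0; lra. Qed.

(* Integrate [Re f] against the square modulus of [1 + x1 e^(imt) + x2 e^(2imt)]. *)
Lemma caratheodory_form (c : nat -> C) (f : C -> C) (m : nat) (x1 x2 : C) :
  (1 <= m)%nat -> has_expansion c f -> c O = 1 ->
  (forall z, 0 < Cmod z < 1 -> 0 <= Re (f z)) ->
  0 <= 1 + Cmod x1 ^ 2 + Cmod x2 ^ 2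
       + Re (Cconj (x1 + x2 * Cconj x1) * c m) + Re (Cconj x2 * c (2 * m)%nat).
Proof.
  intros Hm Hf H0 Hpos.
  pose (w0 := 1 + Cmod x1 ^ 2 + Cmod x2 ^ 2). pose (y1 := (x1 + x2 * Cconj x1)%C).
  pose (q := fun r : R => w0 + Re (Cconj y1 * c m) * r ^ m + Re (Cconj x2 * c (2 * m)%nat) * r ^ (2 * m)).
  replace (_ + _) with (q 1) by (unfold q; rewrite !pow1; unfold w0, y1; ring).
  apply nonneg_at_1.
  { unfold q. apply continuity_pt_plus; [apply continuity_pt_plus|].
    - apply continuity_pt_const. intros a b; reflexivity.
    - apply continuity_pt_scal, derivable_continuous_pt, derivable_pt_pow.
    - apply continuity_pt_scal, derivable_continuous_pt, derivable_pt_pow. }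
  intros r Hr.
  (* The square modulus has the frequencies [0], [m], [-m], [2m], [-2m], one integral for each;
     those of [m] and [2m] vanish. *)
  assert (I0 := fourier_coef c f r (RtoC w0) 0 Hf Hr).
  assert (I1 := fourier_coef_pos c f r y1 m Hm Hf Hr).
  assert (I2 := fourier_coef c f r (Cconj y1) m Hf Hr).
  assert (I3 := fourier_coef_pos c f r x2 (2 * m) ltac:(lia) Hf Hr).
  assert (I4 := fourier_coef c f r (Cconj x2) (2 * m) Hf Hr).
  assert (P := fun a b => is_RInt_plus (V := R_NormedModule) a b 0 (2 * PI)).
  assert (J := P _ _ _ _ (P _ _ _ _ (P _ _ _ _ (P _ _ _ _ I0 I1) I2) I3) I4).
  apply is_RInt_ge_0 in J; [|generalize PI2_pos; lra|].
  - apply (Rmult_le_reg_l (2 * PI)); [apply PI2_pos|]. rewrite Rmult_0_r.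
    refine (Rle_trans _ _ _ J (Req_le _ _ _)). change plus with Rplus. unfold q.
    rewrite H0, <- !RtoC_pow, pow_O. unfold y1, Re; simpl. ring.
  - intros x _. change plus with Rplus; cbv beta.
    set (e := cis (INR m * x)). set (v := f (r * cis x)%C).
    assert (Ee : forall y, cis (- y) = Cconj (cis y)).
    { intros y. unfold cis. rewrite cos_neg, sin_neg. reflexivity. }
    assert (E2 : cis (INR (2 * m) * x) = (e * e)%C).
    { unfold e. rewrite <- cis_plus, mult_INR. f_equal. simpl. ring. }
    assert (He : (e * Cconj e = 1)%C).
    { unfold e. rewrite <- Cmod2_conj, Cmod_cis. f_equal. ring. }
    rewrite !Ropp_mult_distr_l_reverse, !Ee, E2. fold e.
    assert (E0 : cis (INR 0 * x) = 1%C).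
    { simpl. rewrite Rmult_0_l. unfold cis. rewrite cos_0, sin_0. reflexivity. }
    rewrite E0.
    assert (Hv : 0 <= Re v).
    { apply Hpos. rewrite Cmod_mult, Cmod_cis, Cmod_R, Rabs_pos_eq; lra. }
    clearbody v.
    pose (W := Cmod (1 + x1 * e + x2 * (e * e)) ^ 2).
    replace (_ + _) with (W * Re v); [apply Rmult_le_pos; [apply pow2_ge_0|exact Hv]|].
    assert (EW : RtoC W = (w0 + (y1 * e + Cconj y1 * Cconj e) + (x2 * (e * e) + Cconj x2 * (Cconj e * Cconj e)))%C).
    { unfold W. rewrite Cmod2_conj, !Cplus_conj, !Cmult_conj.
      unfold w0, y1. rewrite !RtoC_plus, !Cmod2_conj, !Cplus_conj, !Cmult_conj.
      replace (Cconj 1) with (RtoC 1) by (apply injective_projections; simpl; ring).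
      replace (Cconj (Cconj x1)) with x1 by (apply injective_projections; simpl; ring).
      set (e' := Cconj e) in *.
      set (x1' := Cconj x1). set (x2' := Cconj x2).
      transitivity (1 + x1 * x1' * (e * e') + x2 * x2' * (e * e') * (e * e')
        + (x1 * e + x1' * e') + (x2 * x1' * e * (e * e') + x1 * x2' * e' * (e * e'))
        + (x2 * (e * e) + x2' * (e' * e')))%C; [ring|rewrite He; ring]. }
    assert (EWr : W = Re (w0 + (y1 * e + Cconj y1 * Cconj e) + (x2 * (e * e) + Cconj x2 * (Cconj e * Cconj e))))
      by (rewrite <- EW; reflexivity).
    rewrite EWr. rewrite Cmult_conj. clear. clearbody w0 y1 e.
    unfold Re; simpl. ring.
Qed.

Lemma caratheodory (c : nat -> C) (f : C -> C) (m : nat) :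
  (1 <= m)%nat -> has_expansion c f -> c O = 1 ->
  (forall z, 0 < Cmod z < 1 -> 0 <= Re (f z)) ->
  Cmod (c (2 * m)%nat - c m * c m / 2) <= 2 - Cmod (c m) ^ 2 / 2.
Proof.
  intros Hm Hf H0 Hpos.
  destruct (unit_dual (c (2 * m)%nat - c m * c m / 2)) as [x [Hx1 Hx2]].
  (* In [x1] the form is [|x1|^2 + Re (conj x1 * (c m + x * conj (c m)))] plus a constant; this is
     its minimizer. *)
  pose (x1 := (- (c m + x * Cconj (c m)) / 2)%C).
  assert (H := caratheodory_form c f m x1 x Hm Hf H0 Hpos).
  rewrite Hx1 in H.
  replace (Cmod (c (2 * m)%nat - c m * c m / 2)) with (- Re (Cconj x * (c (2 * m)%nat - c m * c m / 2)))
    by (rewrite Hx2; ring).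
  assert (Hx : Re x ^ 2 + Im x ^ 2 = 1) by (rewrite <- Cmod2_alt, Hx1; ring).
  set (u := c m) in *. set (v := c (2 * m)%nat) in *. clearbody u v. clear - H Hx.
  rewrite Cmod2_alt in H |- *.
  destruct x as [p q], u as [u1 u2], v as [v1 v2]. unfold x1, Re, Im in *.
  simpl in *. field_simplify in H. field_simplify.
  nra.
Qed.

(** * Coefficient bounds and partial sums *)

(** [Re f + Re (conj s * e^(-imx) * g)] is nonnegative for unimodular [s]; its mean over the circle
    is [1 - |d m| r^m] when [s] is dual to [d m]. *)
Lemma dominated_coef_bound (c d : nat -> C) (f g : C -> C) (m : nat) :
  has_expansion c f -> has_expansion d g -> c O = 1 ->
  (forall z, 0 < Cmod z < 1 -> Cmod (g z) <= Re (f z)) -> Cmod (d m) <= 1.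
Proof.
  intros Hf Hg H0 Hdom.
  destruct (unit_dual (d m)) as [s [Hs1 Hs2]].
  pose (q := fun r : R => 1 + - Cmod (d m) * r ^ m).
  assert (Hq : 0 <= q 1); [|unfold q in Hq; rewrite pow1 in Hq; lra].
  apply nonneg_at_1.
  { unfold q. apply continuity_pt_plus; [apply continuity_pt_const; intros a b; reflexivity|].
    apply continuity_pt_scal, derivable_continuous_pt, derivable_pt_pow. }
  intros r Hr.
  assert (J := is_RInt_plus (V := R_NormedModule) _ _ _ _ _ _
    (fourier_coef c f r 1 0 Hf Hr) (fourier_coef d g r (Cconj s) m Hg Hr)).
  apply is_RInt_ge_0 in J; [|generalize PI2_pos; lra|].
  - apply (Rmult_le_reg_l (2 * PI)); [apply PI2_pos|]. rewrite Rmult_0_r.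
    refine (Rle_trans _ _ _ J (Req_le _ _ _)). change plus with Rplus. unfold q.
    rewrite H0, <- Hs2, <- !RtoC_pow, pow_O. unfold Re; simpl. ring.
  - intros x _. change plus with Rplus; cbv beta.
    assert (E0 : cis (- INR 0 * x) = 1%C).
    { simpl. rewrite Ropp_0, Rmult_0_l. unfold cis. rewrite cos_0, sin_0. reflexivity. }
    rewrite E0, !Cmult_1_l.
    assert (Hz : 0 < Cmod (r * cis x) < 1) by (rewrite Cmod_mult, Cmod_cis, Cmod_R, Rabs_pos_eq; lra).
    set (z := (r * cis x)%C) in *. set (e := cis _).
    assert (H1 := re_le_Cmod (Cconj s * e * g z)).
    assert (He : Cmod e = 1) by apply Cmod_cis.
    rewrite !Cmod_mult, Cmod_conj, Hs1, He in H1.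
    generalize (Hdom z Hz). apply Rabs_le_between in H1. lra.
Qed.

Lemma Cmod_add_le_of_rotations (u v : C) (M : R) :
  (forall c : C, Cmod c = 1 -> Cmod (u + c * v) <= M) -> Cmod u + Cmod v <= M.
Proof.
  intros H.
  destruct (Req_dec (Cmod v) 0) as [Ev|Ev].
  { specialize (H 1%C Cmod_1). rewrite Ev. apply Cmod_eq_0 in Ev. rewrite Ev in H.
    replace (u + 1 * 0)%C with u in H by ring. lra. }
  destruct (Req_dec (Cmod u) 0) as [Eu|Eu].
  { specialize (H 1%C Cmod_1). rewrite Eu. apply Cmod_eq_0 in Eu. rewrite Eu in H.
    replace (0 + 1 * v)%C with v in H by ring. lra. }
  assert (Hv : v <> 0%C) by (intros E; apply Ev; rewrite E; apply Cmod_0).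
  assert (Hu : RtoC (Cmod u) <> 0%C) by (intros E; apply RtoC_inj in E; contradiction).
  assert (Hu0 := Cmod_ge_0 u). assert (Hv0 := Cmod_ge_0 v).
  (* This rotation aligns [v] with [u], giving equality in the triangle inequality. *)
  specialize (H (u * Cmod v / (Cmod u * v))%C).
  replace (u + u * Cmod v / (Cmod u * v) * v)%C with (u * (1 + Cmod v / Cmod u)%R)%C in H.
  2: { rewrite RtoC_plus, RtoC_div by exact Eu. field. split; assumption. }
  rewrite Cmod_mult, Cmod_R, Rabs_pos_eq in H by (assert (0 <= Cmod v / Cmod u) by (apply Rdiv_le_0_compat; lra); lra).
  replace (Cmod u * (1 + Cmod v / Cmod u)) with (Cmod u + Cmod v) in H by (field; exact Eu).
  apply H. rewrite Cmod_div by (apply Cmult_neq_0; assumption).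
  rewrite !Cmod_mult, !Cmod_R, !Rabs_pos_eq by assumption. field. split; assumption.
Qed.

(** Removes the weights [1 + alpha n]. The left side is split as [q (v - u^2/2) + (q - p^2) u^2/2];
    the triangle inequality then yields [2 q - p^2 |u|^2/2]. *)
Lemma caratheodory_scale (u v : C) (p q : R) :
  Cmod (v - u * u / 2) <= 2 - Cmod u ^ 2 / 2 -> p ^ 2 <= q <= 1 ->
  Cmod (q * v - (p * u) * (p * u) / 2) <= 2 - Cmod (p * u) ^ 2 / 2.
Proof.
  intros H Hpq.
  replace (q * v - p * u * (p * u) / 2)%C
    with (q * (v - u * u / 2) + ((q - p ^ 2) / 2)%R * (u * u))%C.
  2: { rewrite RtoC_div, RtoC_minus, RtoC_pow by lra. simpl. field. }
  eapply Rle_trans; [apply Cmod_triangle|].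
  assert (Hq : 0 <= q) by (generalize (pow2_ge_0 p); lra).
  rewrite !Cmod_mult, !Cmod_R, (Rabs_pos_eq q), (Rabs_pos_eq (_ / 2)) by lra.
  rewrite Rpow_mult_distr, pow2_abs.
  assert (Hm : q * Cmod (v - u * u / 2) <= q * (2 - Cmod u ^ 2 / 2))
    by (apply Rmult_le_compat_l; assumption).
  nra.
Qed.

Lemma has_expansion_operator (c : nat -> C) (f f1 f2 : C -> C) (alpha : R) :
  has_expansion c f ->
  (forall z, Cmod z < 1 -> has_cderiv f z (f1 z)) ->
  (forall z, Cmod z < 1 -> has_cderiv f1 z (f2 z)) ->
  has_expansion (fun n => (1 + alpha * INR n)%R * (INR (S n) * c (S n)))%C
    (fun z => f1 z + alpha * (z * f2 z))%C.
Proof.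
  intros Hf H1 H2.
  assert (E1 : has_expansion (fun n => INR (S n) * c (S n))%C f1).
  { apply (has_expansion_div (fun n => INR n * c n)%C (fun z => z * f1 z)%C f1);
      [exact (has_expansion_deriv c f f1 Hf H1)|simpl; ring|reflexivity]. }
  refine (has_expansion_ext _ _ _ _ _ (fun z _ => eq_refl)
    (has_expansion_lin _ _ _ _ alpha E1 (has_expansion_deriv _ _ _ E1 H2))).
  intros n. rewrite RtoC_plus, RtoC_mult. ring.
Qed.

(** Padding with zeros lets both partial sums share one length [L]. Degree 1 is cut off because
    [npoly] already contains the term [z]. *)
Definition trunc (a : nat -> C) (p k : nat) : C :=
  if ((2 <=? k) && (k <=? p))%nat%bool then a k else RtoC 0.

Lemma trunc_in (a : nat -> C) (p k : nat) : (2 <= k <= p)%nat -> trunc a p k = a k.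
Proof.
  intros H. unfold trunc.
  destruct (Nat.leb_spec 2 k), (Nat.leb_spec k p); simpl; try reflexivity; lia.
Qed.

Lemma trunc_out (a : nat -> C) (p k : nat) : ~ (2 <= k <= p)%nat -> trunc a p k = 0.
Proof.
  intros H. unfold trunc.
  destruct (Nat.leb_spec 2 k), (Nat.leb_spec k p); simpl; try reflexivity; lia.
Qed.

Lemma INR_Cmod_trunc_le (a b : nat -> C) (p q : nat) (M : R) :
  0 <= M -> (forall n, (1 <= n)%nat -> INR (S n) * (Cmod (a (S n)) + Cmod (b (S n))) <= M) ->
  forall k, INR k * (Cmod (trunc a p k) + Cmod (trunc b q k)) <= M.
Proof.
  intros HM H k. destruct (Nat.le_gt_cases 2 k) as [Hk|Hk].
  - destruct k as [|n]; [lia|]. eapply Rle_trans; [|apply (H n); lia].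
    apply Rmult_le_compat_l; [apply pos_INR|].
    assert (T : forall (d : nat -> C) (j : nat), Cmod (trunc d j (S n)) <= Cmod (d (S n))).
    { intros d j. unfold trunc. destruct (_ && _)%bool; [lra|rewrite Cmod_0; apply Cmod_ge_0]. }
    apply Rplus_le_compat; apply T.
  - rewrite !trunc_out, Cmod_0 by lia. lra.
Qed.

Lemma psum_trunc (a : nat -> C) (p L : nat) (z : C) :
  (p <= L)%nat -> psum (trunc a p) L z = Csum (fun k => Cmul (a k) (Defs.Cpow z k)) 2 p.
Proof.
  intros HL. unfold psum.
  induction HL as [|L HL IH].
  - assert (K : forall j, (j <= p)%nat -> sum_n (fun k => trunc a p k * z ^ k)%C j
        = Csum (fun k => Cmul (a k) (Defs.Cpow z k)) 2 j); [|apply K; lia].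
    induction j as [|j IH]; intros Hj.
    + rewrite sum_O, trunc_out by lia. unfold Csum; simpl.
      change Defs.C0 with (RtoC 0). sum_ring.
    + rewrite Csum_n_S, IH by lia. destruct j as [|j].
      * rewrite trunc_out by lia. unfold Csum; simpl. change Defs.C0 with (RtoC 0). sum_ring.
      * unfold Csum. replace (S (S (S j)) - 2)%nat with (S (S (S j) - 2)) by lia.
        rewrite fold_seq_S. rewrite trunc_in by lia.
        replace (2 + (S (S j) - 2))%nat with (S (S j)) by lia. reflexivity.
  - rewrite Csum_n_S, IH, trunc_out by lia. sum_ring.
Qed.

Lemma s_pq_harm (a b : nat -> C) (p q L : nat) (z : C) :
  (p <= L)%nat -> (q <= L)%nat -> s_pq a b p q z = harm (trunc a p) (trunc b q) L z.
Proof.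
  intros Hp Hq. unfold s_pq, s_h, s_g, harm, npoly. fold (psum (trunc a p) L z).
  rewrite !psum_trunc by assumption. reflexivity.
Qed.

Lemma convex_harmonic_ext (F G : C -> C) (r : R) :
  (forall z, F z = G z) -> convex_harmonic_on_disk G r -> convex_harmonic_on_disk F r.
Proof.
  intros E [HU HC]. split.
  - intros z w Hz Hw. rewrite !E. apply HU; assumption.
  - intros z1 z2 t H1 H2 Ht. destruct (HC z1 z2 t H1 H2 Ht) as [z [Hz Ez]].
    exists z. split; [exact Hz|]. rewrite !E. exact Ez.
Qed.

(** [in_WH0] reads coefficients only from index 2 on, so indices 0 and 1 are filled in: [c1] is 1
    for [h] and 0 for [g]. *)
Definition normalize (c1 : C) (a : nat -> C) (n : nat) : C :=
  match n with O => RtoC 0 | S O => c1 | _ => a n end.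

Lemma has_expansion_normalize (c1 : C) (a : nat -> C) (f : C -> C) :
  (forall z, Cmod z < 1 -> Cseries (fun n => Cmul (a (n + 2)%nat) (Defs.Cpow z (n + 2))) (f z - c1 * z)%C) ->
  has_expansion (normalize c1 a) f.
Proof.
  intros H. apply has_expansion_of_Cseries with a; [reflexivity| |exact H].
  intros n. replace (n + 2)%nat with (S (S n)) by lia. reflexivity.
Qed.

(** * Coefficient bounds for the class *)

Section CoefficientBounds.

Context (alpha beta : R) (a b : nat -> C) (h h1 h2 g g1 g2 : C -> C).
Context (Halpha : alpha >= 0) (Hbeta : 0 <= beta) (HW : in_WH0 alpha beta a b h h1 h2 g g1 g2).

Let kappa (n : nat) : R := 1 + alpha * INR n.
Let P (z : C) : C := (h1 z + alpha * (z * h2 z))%C.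
Let Q (z : C) : C := (g1 z + alpha * (z * g2 z))%C.
Let U (n : nat) : C := (kappa n * (INR (S n) * normalize 1 a (S n)))%C.
Let V (n : nat) : C := (kappa n * (INR (S n) * normalize 0 b (S n)))%C.

Let kappa_ge_1 (n : nat) : 1 <= kappa n.
Proof. unfold kappa. generalize (pos_INR n). nra. Qed.

Let Cnorm_Cmod (z : C) : Cnorm z = Cmod z.
Proof. unfold Cnorm, Cmod. f_equal. ring. Qed.

Let expansion_P : has_expansion U P.
Proof.
  apply has_expansion_operator with h.
  - apply has_expansion_normalize. intros z Hz. rewrite Cmult_1_l.
    apply HW. rewrite Cnorm_Cmod. exact Hz.
  - intros z Hz. apply HW. rewrite Cnorm_Cmod. exact Hz.
  - intros z Hz. apply HW. rewrite Cnorm_Cmod. exact Hz.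
Qed.

Let expansion_Q : has_expansion V Q.
Proof.
  apply has_expansion_operator with g.
  - apply has_expansion_normalize. intros z Hz. replace (g z - 0 * z)%C with (g z) by ring.
    apply HW. rewrite Cnorm_Cmod. exact Hz.
  - intros z Hz. apply HW. rewrite Cnorm_Cmod. exact Hz.
  - intros z Hz. apply HW. rewrite Cnorm_Cmod. exact Hz.
Qed.

Let dominated (z : C) : 0 < Cmod z < 1 -> Cmod (Q z) <= Re (P z).
Proof.
  intros Hz. destruct (HW z) as [_ [_ [_ [_ [_ [_ H]]]]]]; [rewrite Cnorm_Cmod; apply Hz|].
  rewrite Cnorm_Cmod in H. change (Re (P z) - beta > Cmod (Q z)) in H. lra.
Qed.

Let U_0 : U 0 = 1.
Proof. unfold U, kappa. simpl. rewrite Rmult_0_r, Rplus_0_r. ring. Qed.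

Let V_0 : V 0 = 0.
Proof. unfold V. simpl. ring. Qed.

(** By domination, [P + c Q] has nonnegative real part, and its constant coefficient is 1. *)
Let caratheodory_UV (c : C) (m : nat) : Cmod c = 1 -> (1 <= m)%nat ->
  Cmod (U (2 * m) + c * V (2 * m) - (U m + c * V m) * (U m + c * V m) / 2)
  <= 2 - Cmod (U m + c * V m) ^ 2 / 2.
Proof.
  intros Hc Hm.
  apply (caratheodory (fun n => U n + c * V n)%C (fun z => P z + c * Q z)%C m Hm).
  - apply has_expansion_lin; assumption.
  - rewrite U_0, V_0. ring.
  - intros z Hz. rewrite re_plus.
    assert (H1 := re_le_Cmod (c * Q z)). rewrite Cmod_mult, Hc, Rmult_1_l in H1.
    apply Rabs_le_between in H1. generalize (dominated z Hz). lra.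
Qed.

Let scaled_le (u : C) (n : nat) (M : R) : Cmod (kappa n * u) <= M -> Cmod u <= M.
Proof.
  assert (H1 := kappa_ge_1 n). rewrite Cmod_mult, Cmod_R, Rabs_pos_eq by lra.
  generalize (Cmod_ge_0 u). nra.
Qed.

(** The left side of Caratheodory's inequality is nonnegative, which forces [|U n + c V n| <= 2] for
    every rotation [c]; the weight [kappa n >= 1] is then dropped. *)
Lemma coef_sum_bound (n : nat) :
  (1 <= n)%nat -> INR (S n) * (Cmod (a (S n)) + Cmod (b (S n))) <= 2.
Proof.
  intros Hn.
  assert (H : Cmod (U n) + Cmod (V n) <= 2).
  { apply Cmod_add_le_of_rotations. intros c Hc.
    assert (H1 := caratheodory_UV c n Hc Hn).
    generalize (Cmod_ge_0 (U n + c * V n)).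
    generalize (Cmod_ge_0 (U (2 * n) + c * V (2 * n) - (U n + c * V n) * (U n + c * V n) / 2)). nra. }
  unfold U, V in H. destruct n as [|n]; [lia|]. cbn [normalize] in H.
  assert (H1 := kappa_ge_1 (S n)).
  rewrite !Cmod_mult, !Cmod_INR, !Cmod_R, (Rabs_pos_eq (kappa (S n))) in H by lra.
  assert (H2 := pos_INR (S (S n))).
  generalize (Rmult_le_pos _ _ H2 (Cmod_ge_0 (a (S (S n))))) (Rmult_le_pos _ _ H2 (Cmod_ge_0 (b (S (S n))))).
  nra.
Qed.

Lemma analytic_coef_bound (n : nat) : (1 <= n)%nat -> INR (S n) * Cmod (b (S n)) <= 1.
Proof.
  intros Hn. assert (H := dominated_coef_bound U V P Q n expansion_P expansion_Q U_0 dominated).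
  apply scaled_le in H. destruct n as [|n]; [lia|]. cbn [normalize] in H.
  rewrite Cmod_mult, Cmod_INR in H. exact H.
Qed.

Lemma coef_caratheodory (c : C) : Cmod c = 1 ->
  Cmod (3 * (a 3%nat + c * b 3%nat)
        - (2 * (a 2%nat + c * b 2%nat)) * (2 * (a 2%nat + c * b 2%nat)) / 2)
  <= 2 - Cmod (2 * (a 2%nat + c * b 2%nat)) ^ 2 / 2.
Proof.
  intros Hc. assert (H := caratheodory_UV c 1 Hc (le_n 1)).
  assert (K1 := kappa_ge_1 1). assert (K2 := kappa_ge_1 2).
  (* [1 + 2 alpha <= (1 + alpha)^2] is exactly what [caratheodory_scale] needs for the factors
     [1 / kappa 1] and [1 / kappa 2]. *)
  assert (Ek : kappa 2 <= kappa 1 ^ 2) by (unfold kappa; simpl; nra).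
  apply (caratheodory_scale _ _ (/ kappa 1) (/ kappa 2)) in H.
  2: { split.
       - rewrite pow_inv. apply Rinv_le_contravar; lra.
       - rewrite <- Rinv_1. apply Rinv_le_contravar; lra. }
  assert (N1 : RtoC (kappa 1) <> 0%C) by (intros E; apply RtoC_inj in E; lra).
  assert (N2 : RtoC (kappa 2) <> 0%C) by (intros E; apply RtoC_inj in E; lra).
  assert (E1 : (RtoC (/ kappa 1) * (U 1 + c * V 1) = 2 * (a 2%nat + c * b 2%nat))%C).
  { unfold U, V. cbn [normalize]. rewrite RtoC_inv by lra.
    replace (INR 2) with 2 by (simpl; ring). field. exact N1. }
  assert (E2 : (RtoC (/ kappa 2) * (U (2 * 1) + c * V (2 * 1)) = 3 * (a 3%nat + c * b 3%nat))%C).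
  { change (2 * 1)%nat with 2%nat. unfold U, V. cbn [normalize]. rewrite RtoC_inv by lra.
    replace (INR 3) with 3 by (simpl; ring). field. exact N2. }
  rewrite E1, E2 in H. exact H.
Qed.

End CoefficientBounds.

Theorem theorem5p1 (alpha beta : R) (a b : nat -> Cx) (h h1 h2 g g1 g2 : Cx -> Cx)
  (p q : nat) :
  alpha >= 0 -> 0 <= beta < 1 ->
  in_WH0 alpha beta a b h h1 h2 g g1 g2 ->
  (1 <= p)%nat -> (1 <= q)%nat ->
  ((p = 1 /\ p < q)%nat \/ (3 <= p /\ p < q)%nat \/ (3 <= q /\ q < p)%nat) ->
  convex_harmonic_on_disk (s_pq a b p q) (1 / 4).
Proof.
  intros Halpha [Hbeta _] HW Hp Hq Hcases.
  pose (L := Nat.max p q).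
  apply (convex_harmonic_ext _ (harm (trunc a p) (trunc b q) L)).
  { intros z. apply s_pq_harm; unfold L; lia. }
  (* Cases (ii) and (iii) merge: in both, the coefficients of degree 2 and 3 survive the truncation,
     as [coef_caratheodory] requires. *)
  assert (Hpq : p = 1%nat \/ (3 <= p /\ 3 <= q)%nat) by lia.
  destruct Hpq as [->|[Hp3 Hq3]].
  - apply convex_harmonic_identity_analytic; try (apply trunc_out; lia); [unfold L; lia| |].
    + intros k. apply trunc_out. lia.
    + intros k. replace (Cmod (trunc b q k)) with (Cmod (trunc (fun _ => 0%C) q k) + Cmod (trunc b q k)).
      2: { unfold trunc at 1. destruct (_ && _)%bool; rewrite Cmod_0; ring. }
      apply INR_Cmod_trunc_le; [lra|]. intros n Hn. rewrite Cmod_0, Rplus_0_l.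
      exact (analytic_coef_bound alpha beta a b h h1 h2 g g1 g2 Halpha Hbeta HW n Hn).
  - apply convex_harmonic_of_caratheodory; try (apply trunc_out; lia); [unfold L; lia| |].
    + apply INR_Cmod_trunc_le; [lra|]. intros n Hn.
      exact (coef_sum_bound alpha beta a b h h1 h2 g g1 g2 Halpha Hbeta HW n Hn).
    + intros c Hc. cbv beta zeta. rewrite !trunc_in by lia.
      exact (coef_caratheodory alpha beta a b h h1 h2 g g1 g2 Halpha Hbeta HW c Hc).
Qed.
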